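(* Let $\mathbf{k}$ be a field, $R=\mathbf{k}[\![x_1,\dots,x_n]\!]$ with maximal ideal $\mathfrak m$, and let $A=R/I$ be a non-Gorenstein, non-Teter local Artin ring. Then $\mathrm{gcl}(A)=2$ if and only if there exists a polynomial $F=\sum_{i=1}^2\sum_{j=1}^{h_i}a_j^iF_j^i\in\int_{\mathfrak m^2}I^\perp$ (with $a_j^i\in\mathbf{k}$) such that $\{\overline{F_j^i}\}_{1\le i\le2,\,1\le j\le h_i}$ is an adapted $\mathbf{k}$-basis of $\mathcal{L}_{A,2}$ and $(L_1,\dots,L_{n-1},L_n^2)\circ F=I^\perp$ for suitable independent linear forms $L_1,\dots,L_n$ in $R$.
   Context: $S=\mathbf{k}[y_1,\dots,y_n]$ is an $R$-module by contraction: $x^\alpha\circ y^\beta=y^{\beta-\alpha}$ if $\beta\ge\alpha$ componentwise and $0$ otherwise. $I^\perp=\{G\in S: I\circ G=0\}$, $\langle F\rangle=R\circ F$, $\mathrm{Ann}_R F=\{f\in R: f\circ F=0\}$; for an ideal $K$ of $R$, $K\circ F=\{f\circ F:f\in K\}$ and, for an $R$-submodule $M\subset S$, $\int_K M=\{G\in S: K\circ G\subset M\}$. $\ell$ denotes length. $G=R/\mathrm{Ann}_RF$ is a Gorenstein cover of $A=R/I$ if $I^\perp\subset\langle F\rangle$; the Gorenstein colength is $\mathrm{gcl}(A)=\min\{\ell(G)-\ell(A)\}$ over all Gorenstein covers $G$ of $A$. $A$ is a Teter ring if $A\cong G/\mathrm{soc}(G)$ for some Artin Gorenstein local ring $G$.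 $\mathcal{L}_{A,2}=\int_{\mathfrak m^2}I^\perp/I^\perp$. An adapted $\mathbf{k}$-basis of $\mathcal{L}_{A,2}$ is a $\mathbf{k}$-basis $\overline{F_j^i}$, $i=1,2$, $1\le j\le h_i$, such that for each $i$, $F_1^i,\dots,F_{h_i}^i\in\int_{\mathfrak m^i}I^\perp$ and their cosets form a $\mathbf{k}$-basis of $\int_{\mathfrak m^i}I^\perp/\int_{\mathfrak m^{i-1}}I^\perp$ (with $\mathfrak m^0=R$, $\int_RI^\perp=I^\perp$). *)

(* Defs.v *)
From HB Require Import structures.
From mathcomp Require Import all_boot all_order all_algebra ring_quotient.
From mathcomp Require Import boolp classical_sets.
From mathcomp Require Import mpoly.

Set Implicit Arguments.
Unset Strict Implicit.
Unset Printing Implicit Defensive.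

Import GRing.Theory.
Local Open Scope classical_set_scope.
Local Open Scope ring_scope.

Record mpseries (n : nat) (k : fieldType) :=
  MPSeries { pscoef : 'X_{1..n} -> k }.

Notation "{ 'mpseries' k [ n ] }" := (mpseries n k)
  (at level 0, k at level 2, n at level 2, format "{ 'mpseries'  k [ n ] }")
  : type_scope.

Section PowerSeriesRing.
Variables (n : nat) (k : fieldType).
Local Notation R := {mpseries k[n]}.
Implicit Types (f g h : R) (m : 'X_{1..n}).

Lemma pscoefP f g : (forall m, pscoef f m = pscoef g m) -> f = g.
Proof. by case: f g => [f] [g] /= fg; congr MPSeries; apply: funext. Qed.

HB.instance Definition _ := gen_eqMixin R.
HB.instance Definition _ := gen_choiceMixin R.

Definition ps_zero : R := MPSeries (fun=> 0).
Definition ps_opp f : R := MPSeries (fun m => - pscoef f m).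
Definition ps_add f g : R := MPSeries (fun m => pscoef f m + pscoef g m).
Definition ps_one : R := MPSeries (fun m => (m == 0%MM)%:R).
(* Every exponent b <= m has degree at most mdeg m, so the index type of the
   sum contains all of them. *)
Definition ps_mul f g : R := MPSeries (fun m =>
  \sum_(b : 'X_{1..n < (mdeg m).+1} | (b <= m)%MM)
     pscoef f b * pscoef g (m - b)%MM).
Definition ps_scale (c : k) f : R := MPSeries (fun m => c * pscoef f m).

Fact ps_addA : associative ps_add.
Proof. by move=> f g h; apply: pscoefP => m /=; rewrite addrA. Qed.
Fact ps_addC : commutative ps_add.
Proof. by move=> f g; apply: pscoefP => m /=; rewrite addrC. Qed.
Fact ps_add0 : left_id ps_zero ps_add.
Proof. by move=> f; apply: pscoefP => m /=; rewrite add0r. Qed.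
Fact ps_addN : left_inverse ps_zero ps_opp ps_add.
Proof. by move=> f; apply: pscoefP => m /=; rewrite addNr. Qed.

HB.instance Definition _ :=
  GRing.isZmodule.Build R ps_addA ps_addC ps_add0 ps_addN.

(* The ring axioms are transported from polynomials by truncation. *)
Definition ps_trunc (d : nat) f : {mpoly k[n]} :=
  \sum_(b : 'X_{1..n < d}) pscoef f b *: 'X_[b].

Lemma ps_truncE d f m : (mdeg m < d)%N -> (ps_trunc d f)@_m = pscoef f m.
Proof.
move=> md; rewrite /ps_trunc raddf_sum /=.
rewrite (bigD1 (BMultinom md)) //= mcoeffZ mcoeffX eqxx mulr1 big1 ?addr0 //.
move=> b nb; rewrite mcoeffZ mcoeffX; case: eqP => [E|]; last by rewrite mulr0.
by case/eqP: nb; apply: val_inj.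
Qed.

Lemma mcoeffM_le (p q : {mpoly k[n]}) m : (p * q)@_m =
  \sum_(b : 'X_{1..n < (mdeg m).+1} | (b <= m)%MM) p@_b * q@_(m - b)%MM.
Proof. exact: mcoeff_poly_mul_lin. Qed.

Lemma ps_mulE d f g m : (mdeg m < d)%N ->
  pscoef (ps_mul f g) m = (ps_trunc d f * ps_trunc d g)@_m.
Proof.
move=> md; rewrite mcoeffM_le /=.
apply: eq_bigr => b bm; have bd : (mdeg b < d)%N.
  by apply: leq_ltn_trans md; rewrite -ltnS bmdeg.
by rewrite !ps_truncE // (leq_ltn_trans _ md) // mdegB.
Qed.

Lemma mcoeff_mul_low d (p p' q q' : {mpoly k[n]}) m : (mdeg m < d)%N ->
    (forall b, (mdeg b < d)%N -> p@_b = p'@_b) ->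
    (forall b, (mdeg b < d)%N -> q@_b = q'@_b) ->
  (p * q)@_m = (p' * q')@_m.
Proof.
move=> md pp' qq'; rewrite !mcoeffM_le.
apply: eq_bigr => b bm; rewrite pp' ?qq' //.
  by rewrite (leq_ltn_trans _ md) // mdegB.
by apply: leq_ltn_trans md; rewrite -ltnS bmdeg.
Qed.

Fact ps_mulA : associative ps_mul.
Proof.
move=> f g h; apply: pscoefP => m; set d := (mdeg m).+1.
rewrite !(@ps_mulE d) ?ltnSn //.
transitivity ((ps_trunc d f * (ps_trunc d g * ps_trunc d h))@_m).
  apply: (@mcoeff_mul_low d) => // b bd.
  by rewrite ps_truncE // (ps_mulE _ _ bd).
rewrite mulrA; apply: (@mcoeff_mul_low d) => // b bd.
by rewrite ps_truncE // (ps_mulE _ _ bd).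
Qed.

Fact ps_mulC : commutative ps_mul.
Proof.
move=> f g; apply: pscoefP => m.
by rewrite !(@ps_mulE (mdeg m).+1) // mulrC.
Qed.

Fact ps_mul1 : left_id ps_one ps_mul.
Proof.
move=> f; apply: pscoefP => m; set d := (mdeg m).+1.
rewrite (@ps_mulE d) //.
transitivity ((1 * ps_trunc d f)@_m); last by rewrite mul1r ps_truncE.
apply: (@mcoeff_mul_low d) => // b bd.
by rewrite ps_truncE // mcoeff1.
Qed.

Fact ps_mulD : left_distributive ps_mul ps_add.
Proof.
move=> f g h; apply: pscoefP => m /=; rewrite -big_split /=.
by apply: eq_bigr => b _; rewrite mulrDl.
Qed.

Fact ps_one_neq0 : ps_one != 0.
Proof.
apply/eqP => /(congr1 (fun f : R => pscoef f 0%MM)) /= /eqP.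
by rewrite eqxx oner_eq0.
Qed.

HB.instance Definition _ := GRing.Zmodule_isComNzRing.Build R
  ps_mulA ps_mulC ps_mul1 ps_mulD ps_one_neq0.

Fact ps_scaleA a b f : ps_scale a (ps_scale b f) = ps_scale (a * b) f.
Proof. by apply: pscoefP => m /=; rewrite mulrA. Qed.
Fact ps_scale1 : left_id 1 ps_scale.
Proof. by move=> f; apply: pscoefP => m /=; rewrite mul1r. Qed.
Fact ps_scaleDr : right_distributive ps_scale +%R.
Proof. by move=> a f g; apply: pscoefP => m /=; rewrite mulrDr. Qed.
Fact ps_scaleDl f : {morph ps_scale^~ f : a b / a + b}.
Proof. by move=> a b; apply: pscoefP => m /=; rewrite mulrDl. Qed.

HB.instance Definition _ := GRing.Zmodule_isLmodule.Build k R
  ps_scaleA ps_scale1 ps_scaleDr ps_scaleDl.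

End PowerSeriesRing.

Section Ideals.
Variable A : comNzRingType.
Implicit Types (J K m : set A).

Definition is_ideal J :=
  [/\ J 0, forall a b, J a -> J b -> J (a + b) & forall c a, J a -> J (c * a)].

Definition ideal_span (S : set A) : set A :=
  [set a | exists (r : nat) (c s : 'I_r -> A),
             (forall i, S (s i)) /\ a = \sum_(i < r) c i * s i].

Definition ideal_mul J K : set A :=
  ideal_span [set a | exists x y, [/\ J x, K y & a = x * y]].

Fixpoint ideal_pow J (i : nat) : set A :=
  if i is i'.+1 then ideal_mul J (ideal_pow J i') else setT.

Definition is_maximal_ideal m :=
  [/\ is_ideal m, ~ m 1 &
      forall J, is_ideal J -> m `<=` J -> J = m \/ J = setT].

Definition is_local m :=
  is_maximal_ideal m /\ (forall m', is_maximal_ideal m' -> m' = m).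

Definition artinian :=
  forall J : nat -> set A, (forall i, is_ideal (J i)) ->
    (forall i, J i.+1 `<=` J i) ->
  exists N, forall i, (N <= i)%N -> J i = J N.

Definition socle m : set A := [set a | forall b, m b -> a * b = 0].

(* For an Artinian local ring, being Gorenstein means that the socle is a
   one-dimensional vector space over A/m; as m kills the socle, its A/m-lines
   are the sets {c * s | c in A}. *)
Definition artin_gorenstein_local m :=
  [/\ is_local m, artinian &
      exists s, [/\ socle m s, s != 0 &
                    forall t, socle m t -> exists c, t = c * s]].

Definition ideal_chain (l : nat) (J : nat -> set A) :=
  (forall i, (i <= l)%N -> is_ideal (J i)) /\
  (forall i, (i < l)%N -> J i `<` J i.+1).

End Ideals.

Definition artin_local (A : comNzRingType) :=
  artinian A /\ exists m : set A, is_local m.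

Definition gorenstein (A : comNzRingType) :=
  exists m : set A, artin_gorenstein_local m.

(* A surjective ring morphism with kernel soc(G) is an isomorphism
   G/soc(G) ~ A. *)
Definition teter (A : comNzRingType) :=
  exists (G : comNzRingType) (m : set G) (phi : {rmorphism G -> A}),
    [/\ artin_gorenstein_local m,
        forall a, exists g, phi g = a &
        forall g, phi g = 0 <-> socle m g].

(* The length of A as a module over itself: submodules are ideals, and l is the
   largest number of strict inclusions in a chain of ideals. *)
Definition has_length (A : comNzRingType) (l : nat) :=
  (exists J : nat -> set A, ideal_chain l J) /\
  (forall l' (J : nat -> set A), ideal_chain l' J -> (l' <= l)%N).

Section InverseSystems.
Variables (n : nat) (k : fieldType).
Local Notation R := {mpseries k[n]}.
Local Notation S := {mpoly k[n]}.
Implicit Types (f : R) (F G : S) (K : set R) (M N : set S).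

Definition contract_mon (a : 'X_{1..n}) G : S :=
  \sum_(b <- msupp G | (a <= b)%MM) G@_b *: 'X_[(b - a)%MM].

(* The monomials x^a with mdeg a >= msize G act on G by 0. *)
Definition contract f G : S :=
  \sum_(a : 'X_{1..n < msize G}) pscoef f a *: contract_mon a G.

Definition contract_set K F : set S := [set contract f F | f in K].

Definition cyclic_submod F : set S := contract_set setT F.

Definition perp K : set S := [set G | forall f, K f -> contract f G = 0].

Definition ann F : set R := [set f | contract f F = 0].

Definition integral_mod K M : set S :=
  [set G | forall f, K f -> M (contract f G)].

Definition ps_maxideal : set R := [set f | pscoef f 0%MM = 0].

Definition is_linear_form f := forall a, pscoef f a != 0 -> mdeg a = 1%N.

Definition independent_forms (L : 'I_n -> R) :=
  forall c : 'I_n -> k, \sum_(i < n) c i *: L i = 0 -> forall i, c i = 0.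

Definition last_squared_ideal (L : 'I_n -> R) : set R :=
  ideal_span [set (if i.+1 == n then L i ^+ 2 else L i) | i in [set: 'I_n]].

(* The cosets of the family b form a k-basis of M/N. *)
Definition basis_mod (T : finType) N M (b : T -> S) :=
  [/\ forall t, M (b t),
      forall G, M G -> exists c : T -> k, N (G - \sum_t c t *: b t) &
      forall c : T -> k, N (\sum_t c t *: b t) -> forall t, c t = 0].

(* For i = 0 this is the integral over R, that is, perp I. *)
Definition level (I : set R) (i : nat) : set S :=
  integral_mod (ideal_pow ps_maxideal i) (perp I).

(* An adapted basis of L_{A,q}, for A = R/I: the index i : 'I_q stands for the
   upper index i + 1, whose layer is level (i + 1) modulo level i. *)
Definition adapted_basis (I : set R) (q : nat) (h : 'I_q -> nat)
    (b : forall i : 'I_q, 'I_(h i) -> S) :=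
  basis_mod (perp I) (level I q)
    (fun t : {i : 'I_q & 'I_(h i)} => b (tag t) (tagged t)) /\
  (forall i : 'I_q, basis_mod (level I i) (level I i.+1) (b i)).

(* G = R/J is a Gorenstein cover of A = R/I; as J is proper, F != 0. *)
Definition gorenstein_cover (I J : idealr R) :=
  exists F : S, [set` J] = ann F /\ perp [set` I] `<=` cyclic_submod F.

Definition cover_colength (I J : idealr R) (c : nat) :=
  exists lG lA : nat, [/\ has_length {ideal_quot J} lG,
    has_length {ideal_quot I} lA & lG = (lA + c)%N].

Definition has_gcl (I : idealr R) (c : nat) :=
  (exists J, gorenstein_cover I J /\ cover_colength I J c) /\
  (forall J c', gorenstein_cover I J -> cover_colength I J c' -> (c <= c')%N).

End InverseSystems.

(* Main.v *)
Require Import Defs.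
From HB Require Import structures.
From mathcomp Require Import all_boot all_order all_algebra ring_quotient.
From mathcomp Require Import boolp classical_sets.
From mathcomp Require Import ssrcomplements mpoly ring zify.
Import GRing.Theory.
Local Open Scope classical_set_scope.
Local Open Scope ring_scope.

(* If [G = R/Ann F] covers [A = R/I], put [K = {f | f o F in I^perp}], so that
   [I^perp = K o F]. The form (f, g) |-> (f g o F)(0) on [R/Ann F] is perfect and [K]
   is orthogonal to [I], hence l(G) - l(A) = l(R/K). Length 0 makes [A = G]
   Gorenstein; length 1 gives [K = m], hence [I = (Ann F : m)] and [A = G/soc G] is
   Teter. Thus gcl(A) >= 2 under the hypotheses, and equality means that some [K]
   has colength 2, i.e. K = (L_1, .., L_(n-1), L_n^2) for independent linear forms.
   Then [m^2 <= K] and [m </= K], so [F] lies in the second layer but not in the first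
   one and can be taken as a member of an adapted basis. *)

(** * Power series by order of vanishing *)

Section PowerSeries.
Set Implicit Arguments.
Unset Strict Implicit.
Unset Printing Implicit Defensive.
Variables (n : nat) (k : fieldType).
Local Notation R := {mpseries k[n]}.
Local Notation S := {mpoly k[n]}.
Implicit Types (f g h : R) (F G : S).

(** Every length is turned into the rank of a matrix over [k]: an ideal containing m^s is a row
    space in the finite-dimensional R/m^s, and since [k] is the residue field, colength is
    codimension. The obstacle is to find such an [s] for [I]: artinianity speaks of chains in A and
    gives only m^s <= I + m^(s+1), and Nakayama's lemma has to remove the second summand. For a
    cover the truncation is at [msize F], because m^(msize F) kills [F]. In the converse direction
    the equation (L_1, .., L_n^2) o F = I^perp gives only the inclusion of (L_1, .., L_n^2) in K,
    hence colength at most 2; equality comes from the exclusion of colengths 0 and 1. *)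

Lemma pscoefD f g m : pscoef (f + g) m = pscoef f m + pscoef g m.
Proof. by []. Qed.

Lemma pscoefN f m : pscoef (- f) m = - pscoef f m.
Proof. by []. Qed.

Lemma pscoefZ (c : k) f m : pscoef (c *: f) m = c * pscoef f m.
Proof. by []. Qed.

Lemma pscoef1 m : pscoef (1 : R) m = (m == 0%MM)%:R.
Proof. by []. Qed.

Lemma pscoef_sum (T : Type) (r : seq T) (P : pred T) (f : T -> R) m :
  pscoef (\sum_(i <- r | P i) f i) m = \sum_(i <- r | P i) pscoef (f i) m.
Proof. exact: (big_morph (fun f => pscoef f m) (fun f g => pscoefD f g m)). Qed.

(** The bound [d] is free, so that coefficients at different exponents can be expanded over one
    index type. *)
Lemma pscoefM d f g m : (mdeg m < d)%N -> pscoef (f * g) m =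
  \sum_(b : 'X_{1..n < d} | (b <= m)%MM) pscoef f b * pscoef g (m - b)%MM.
Proof.
move=> md; rewrite [LHS](ps_mulE _ _ md) (mcoeff_poly_mul_lin _ _ md).
by apply: eq_bigr => b bm; rewrite !ps_truncE ?bmdeg // (leq_ltn_trans (mdegB _ _)).
Qed.

(** The residue map of the local ring; as a ring morphism it commutes with determinants, which
    Nakayama's lemma uses. *)
Definition const_coef f := pscoef f 0%MM.

Lemma const_coef_zmod : zmod_morphism const_coef.
Proof. by []. Qed.

Lemma const_coef_monoid : monoid_morphism const_coef.
Proof.
split=> [|f g]; first by rewrite /const_coef pscoef1 eqxx.
rewrite /const_coef (@pscoefM 1) ?mdeg0 // (bigD1 bm0) ?lepm_refl //=.
rewrite subm0 big1 ?addr0 // => b /andP[_ /eqP[]].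
by apply: val_inj; apply/eqP; rewrite -mdeg_eq0 -leqn0 -ltnS bmdeg.
Qed.

HB.instance Definition _ := GRing.isZmodMorphism.Build R k const_coef const_coef_zmod.
HB.instance Definition _ := GRing.isMonoidMorphism.Build R k const_coef const_coef_monoid.

Definition psmon (a : 'X_{1..n}) : R := MPSeries (fun m => (m == a)%:R).

Lemma pscoef_monM a f m :
  pscoef (psmon a * f) m = if (a <= m)%MM then pscoef f (m - a)%MM else 0.
Proof.
rewrite (@pscoefM (mdeg m + mdeg a).+1) ?ltnS ?leq_addr //.
case: ifP => am; last first.
  rewrite big1 // => b bm /=; case: eqP => [E|_]; last by rewrite mul0r.
  by rewrite -E bm in am.
have ad : (mdeg a < (mdeg m + mdeg a).+1)%N by rewrite ltnS leq_addl.
rewrite (bigD1 (BMultinom ad)) //= eqxx mul1r big1 ?addr0 // => b /andP[_ nb].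
case: eqP => [E|_]; last by rewrite mul0r.
by case/eqP: nb; apply: val_inj.
Qed.

Lemma psmon0 : psmon 0 = 1.
Proof. by apply: pscoefP. Qed.

(** The series carry a ring and a [k]-module structure; this link lets ideals absorb scalars. *)
Lemma scale_psE (c : k) f : c *: f = (c *: (1 : R)) * f.
Proof.
apply: pscoefP => m; rewrite (@pscoefM (mdeg m).+1) //.
rewrite (bigD1 bm0) /=; last by apply/mnm_lepP => i; rewrite mnm0E.
rewrite eqxx mulr1 subm0 big1 ?addr0 // => b /andP[_ nb].
case: eqP => [E|_]; last by rewrite mulr0 mul0r.
by case/eqP: nb; apply: val_inj.
Qed.

Lemma scale_psAl (c : k) f g : c *: (f * g) = (c *: f) * g.
Proof. by rewrite scale_psE mulrA -scale_psE. Qed.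

(** The ideal m^d, given by coefficients so that membership needs no expression as a sum of
    products. *)
Definition ord_ge (d : nat) : set R :=
  [set f | forall m, (mdeg m < d)%N -> pscoef f m = 0].

Lemma ord_ge_ideal d : is_ideal (ord_ge d).
Proof.
split=> [//|f g f0 g0 m md|h f f0 m md]; first by rewrite pscoefD f0 ?g0 ?addr0.
rewrite (@pscoefM d) // big1 // => b bm.
by rewrite (f0 (_ - _)%MM) ?mulr0 // (leq_ltn_trans (mdegB _ _)).
Qed.

Lemma ord_geM d e f g : ord_ge d f -> ord_ge e g -> ord_ge (d + e) (f * g).
Proof.
move=> f0 g0 m md; rewrite (@pscoefM (d + e)) // big1 // => b bm.
case: (ltnP (mdeg b) d) => bd; first by rewrite f0 ?mul0r.
rewrite (g0 (_ - _)%MM) ?mulr0 //.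
by rewrite -(ltn_add2l d) (leq_ltn_trans _ md) // -{2}(submK bm) mdegD addnC leq_add2l.
Qed.

Lemma ord_geX f i : ord_ge 1 f -> ord_ge i (f ^+ i).
Proof.
move=> f1; elim: i => [|i IH]; first by move=> m.
by rewrite exprS -add1n; apply: ord_geM.
Qed.

Lemma ord_ge_leq d e f : (d <= e)%N -> ord_ge e f -> ord_ge d f.
Proof. by move=> de f0 m md; apply: f0; apply: leq_trans de. Qed.

Lemma ord_ge1 f : ord_ge 1 f <-> pscoef f 0%MM = 0.
Proof.
split=> [f0|f0 m]; first by apply: f0; rewrite mdeg0.
by rewrite ltnS leqn0 mdeg_eq0 => /eqP ->.
Qed.

Lemma ord_ge_psmon a : ord_ge (mdeg a) (psmon a).
Proof. by move=> m; rewrite /=; case: eqP => // ->; rewrite ltnn. Qed.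

Definition psX (i : 'I_n) : R := psmon U_(i)%MM.

Lemma ord_ge_psX i : ord_ge 1 (psX i).
Proof. by rewrite -(mdeg1 i); apply: ord_ge_psmon. Qed.

(* The monomial [m] of [f] is assigned to the generator [psX i] for the [i]
   that [pick] returns among the variables dividing [m]. *)
Lemma ord_ge_decomp d f : ord_ge d.+1 f ->
  exists g : 'I_n -> R, (forall i, ord_ge d (g i)) /\ f = \sum_i psX i * g i.
Proof.
move=> f0; pose s (m : 'X_{1..n}) := [pick i | m i != 0%N].
pose g i : R := MPSeries (fun m => if s (m + U_(i))%MM == Some i
                                   then pscoef f (m + U_(i))%MM else 0).
exists g; split=> [i m md /=|].
  by case: ifP => // _; apply: f0; rewrite mdegD mdeg1 addn1 ltnS.
apply: pscoefP => m; rewrite pscoef_sum.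
transitivity (\sum_i if s m == Some i then pscoef f m else 0).
  rewrite /s; case: pickP => [i mi|m0].
    rewrite (bigD1 i) //= eqxx big1 ?addr0 // => j ji.
    by case: eqP => // -[] E; rewrite E eqxx in ji.
  rewrite big1 // f0 //; suff -> : m = 0%MM by rewrite mdeg0.
  by apply/mnmP => i; rewrite mnm0E; apply/eqP; move: (m0 i) => /negbFE.
apply: eq_bigr => i _; rewrite pscoef_monM /=.
case: ifP => [E|E]; case: ifP => [im|im] //; rewrite ?submK ?E //.
move: E; rewrite /s; case: pickP => // j mj /eqP[E]; rewrite -{}E {i} in im.
move/negP: im; case; apply/mnm_lepP => l; rewrite mnm1E.
by case: eqP => // <-; rewrite lt0n.
Qed.

(** The inverse is the geometric series: since [y ^+ i] vanishes to order [i], its coefficient at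
    [m] is that of the partial sum of length [(mdeg m).+1]. *)
Lemma unit_1Bps y : ord_ge 1 y -> exists g, g * (1 - y) = 1.
Proof.
move=> y1; pose gs d : R := \sum_(i < d) y ^+ i.
pose g : R := MPSeries (fun m => pscoef (gs (mdeg m).+1) m).
have gsE d m : (mdeg m < d)%N -> pscoef g m = pscoef (gs d) m.
  move=> md /=; rewrite /gs !pscoef_sum -(subnKC md) big_split_ord /=.
  rewrite [X in _ + X]big1 ?addr0 // => i _.
  have [_ _ idl] := ord_ge_ideal (mdeg m).+1.
  by rewrite exprD mulrC idl //; apply: ord_geX.
exists g; apply: pscoefP => m; set d := (mdeg m).+1; rewrite mulrC.
have -> : pscoef ((1 - y) * g) m = pscoef ((1 - y) * gs d) m.
  rewrite !(@pscoefM d) //; apply: eq_bigr => b bm; congr (_ * _).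
  by apply: gsE; rewrite (leq_ltn_trans (mdegB _ _)).
rewrite -opprB mulNr -subrX1 opprB pscoefD pscoefN (ord_geX (i := d) y1) //.
by rewrite subr0.
Qed.

Lemma unit_ps f : pscoef f 0%MM != 0 -> exists g, g * f = 1.
Proof.
move=> f0; set c := pscoef f 0%MM.
have [g gf] : exists g, g * (1 - (1 - c^-1 *: f)) = 1.
  apply: unit_1Bps; apply/ord_ge1.
  by rewrite pscoefD pscoefN pscoefZ pscoef1 eqxx mulVf ?subrr.
exists (c^-1 *: g); rewrite -scale_psAl mulrC scale_psAl mulrC -[RHS]gf.
by rewrite opprB addrCA subrr addr0.
Qed.

Lemma psD0 f : exists f1, ord_ge 1 f1 /\ f = pscoef f 0%MM *: (1 : R) + f1.
Proof.
exists (f - pscoef f 0%MM *: (1 : R)); split; last by rewrite addrC subrK.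
by apply/ord_ge1; rewrite pscoefD pscoefN pscoefZ pscoef1 eqxx mulr1 subrr.
Qed.

(** The generators are the words of length [d] in the variables. Tracking the order [e] of the
    coefficients serves Nakayama's lemma: for [e = 1] they lie in the maximal ideal. *)
Lemma ord_ge_fg d : exists (r : nat) (u : 'I_r -> R), (forall i, ord_ge d (u i)) /\
  forall e f, ord_ge (d + e) f ->
    exists g : 'I_r -> R, (forall i, ord_ge e (g i)) /\ f = \sum_i g i * u i.
Proof.
suff [T [u [u1 uP]]] : exists (T : finType) (u : T -> R), (forall i, ord_ge d (u i)) /\
    forall e f, ord_ge (d + e) f ->
    exists g : T -> R, (forall i, ord_ge e (g i)) /\ f = \sum_i g i * u i.
  exists #|T|, (u \o enum_val); split=> [i|e f /uP[g [g1 ->]]]; first exact: u1.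
  exists (g \o enum_val); split=> [i|]; first exact: g1.
  by rewrite (reindex (fun i : 'I_#|T| => enum_val i)) //=; apply/onW_bij/enum_val_bij.
elim: d => [|d [T [u [u1 uP]]]].
  exists unit, (fun=> 1); split=> [i m //|e f fe].
  exists (fun=> f); split=> //.
  by rewrite (big_pred1 tt) ?mulr1 // => -[].
exists ('I_n * T)%type, (fun p => psX p.1 * u p.2); split=> [[i t]|e f].
  by rewrite -add1n; apply: ord_geM; [apply: ord_ge_psX | apply: u1].
rewrite addSn => /ord_ge_decomp[v [vd ->]].
have /choice[g gP] i := uP e _ (vd i).
exists (fun p => g p.1 p.2); split=> [[i t]|]; first exact: (gP i).1.
rewrite -(pair_bigA _ (fun i t => g i t * (psX i * u t))) /=.
apply: eq_bigr => i _; rewrite {1}(gP i).2 mulr_sumr.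
by apply: eq_bigr => t _; rewrite mulrCA.
Qed.

(* Nakayama: modulo [I] the generators [u] satisfy [u = G u] with [G] over the
   maximal ideal, and det (1 - G) is a unit that kills them. *)
Lemma nakayama_ord_ge (I : set R) d : is_ideal I ->
  (forall f, ord_ge d f -> exists2 w, I w & ord_ge d.+1 (f - w)) -> ord_ge d `<=` I.
Proof.
move=> [I0 ID IM] HI; have Isum (T : finType) (F : T -> R) :
    (forall t, I (F t)) -> I (\sum_t F t).
  by move=> IF; elim/big_ind: _ => //.
have [r [u [u1 uP]]] := ord_ge_fg d.
have /choice[g gP] i : exists g : 'I_r -> R, (forall j, ord_ge 1 (g j)) /\
    I (u i - \sum_j g j * u j).
  have [w Iw] := HI _ (u1 i); rewrite -addn1 => /uP[g [g1 E]].
  by exists g; split=> //; rewrite -E opprB addrC subrK.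
pose A : 'M[R]_r := 1%:M - \matrix_(i, j) g i j.
have detA : pscoef (\det A) 0%MM = 1.
  rewrite -[LHS]/(const_coef _) -det_map_mx; apply: etrans (det1 _ r).
  congr (\det _); apply/matrixP => i j; rewrite !mxE /=.
  have /ord_ge1 -> := (gP i).1 j.
  by rewrite subr0; case: (i == j) => //=; rewrite eqxx.
have [v vA] : exists v, v * \det A = 1 by apply: unit_ps; rewrite detA oner_neq0.
have Iu i : I (u i).
  have Idet : I (\det A * u i).
    pose U : 'cV[R]_r := \col_i u i.
    have : (\adj A *m (A *m U)) i 0 = \det A * u i.
      by rewrite mulmxA mul_adj_mx mul_scalar_mx !mxE.
    move<-; rewrite mxE; apply: Isum => j; apply: IM.
    rewrite mulmxBl mul1mx !mxE (eq_bigr (fun l => g j l * u l)); last first.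
      by move=> l _; rewrite !mxE.
    exact: (gP j).2.
  by rewrite -[u i]mul1r -vA -mulrA; apply: IM.
move=> f; rewrite -[d]addn0 => /uP[c [_ ->]].
by apply: Isum => i; apply: IM.
Qed.

End PowerSeries.

(** * Contraction *)

Section Contraction.
Set Implicit Arguments.
Unset Strict Implicit.
Unset Printing Implicit Defensive.
Variables (n : nat) (k : fieldType).
Local Notation R := {mpseries k[n]}.
Local Notation S := {mpoly k[n]}.
Implicit Types (f g h : R) (F G : S).

Lemma mcoeff_msize G m : (msize G <= mdeg m)%N -> G@_m = 0.
Proof. by move/msize_mdeg_ge; rewrite -mcoeff_eq0 => /eqP. Qed.

Lemma mcoeff_contract_mon a G c : (contract_mon a G)@_c = G@_(a + c)%MM.
Proof.
rewrite /contract_mon raddf_sum /=.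
have E b : (a <= b)%MM -> ((b - a)%MM == c) = (b == (a + c)%MM).
  by move=> ab; rewrite -{2}(submK ab) addmC (inj_eq (@addmI _ a)).
transitivity (\sum_(b <- msupp G | b == (a + c)%MM) G@_b).
  rewrite [RHS]big_mkcond [LHS]big_mkcond /=; apply: eq_bigr => b _.
  case: ifP => ab; first by rewrite mcoeffZ mcoeffX E //; case: eqP; rewrite (mulr1, mulr0).
  by case: eqP => // Eb; rewrite Eb lem_addr in ab.
have [ac|ac] := boolP ((a + c)%MM \in msupp G).
  by rewrite (big_rem _ ac) /= eqxx big_seq_cond big1 ?addr0 // => b /andP[]; rewrite
     mem_rem_uniq ?msupp_uniq // inE => /andP[/negPf->].
rewrite big_seq_cond big1 => [|b /andP[bG /eqP E1]]; last by rewrite E1 (negPf ac) in bG.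
by apply/esym/eqP; rewrite mcoeff_eq0.
Qed.

Lemma sum_bmultinom_widen d e (H : 'X_{1..n} -> k) : (d <= e)%N ->
    (forall m, (d <= mdeg m)%N -> H m = 0) ->
  \sum_(a : 'X_{1..n < d}) H a = \sum_(a : 'X_{1..n < e}) H a.
Proof.
move=> de H0.
rewrite (big_sub_widen 'X_{1..n < d} 'X_{1..n < e} xpredT H) /=.
  by rewrite big_rmcond //= => a; rewrite -leqNgt; apply: H0.
by move=> x /leq_trans; apply.
Qed.

(** Beyond [msize G] the terms vanish, so any larger bound is allowed and several contractions can
    share one index type. *)
Lemma mcoeff_contract d f G c : (msize G <= d)%N ->
  (contract f G)@_c = \sum_(a : 'X_{1..n < d}) pscoef f a * G@_(a + c)%MM.
Proof.
move=> Gd; rewrite -(sum_bmultinom_widen (H := fun a => pscoef f a * G@_(a + c)%MM) Gd).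
  by rewrite /contract raddf_sum /=; apply: eq_bigr => a _; rewrite mcoeffZ mcoeff_contract_mon.
by move=> m md; rewrite mcoeff_msize ?mulr0 // mdegD (leq_trans md) ?leq_addr.
Qed.

Lemma contractDl f g G : contract (f + g) G = contract f G + contract g G.
Proof.
apply/mpolyP => c; rewrite mcoeffD !(@mcoeff_contract (msize G)) // -big_split.
by apply: eq_bigr => a _; rewrite pscoefD mulrDl.
Qed.

Lemma contractZl (x : k) f G : contract (x *: f) G = x *: contract f G.
Proof.
apply/mpolyP => c; rewrite mcoeffZ !(@mcoeff_contract (msize G)) // mulr_sumr.
by apply: eq_bigr => a _; rewrite pscoefZ mulrA.
Qed.

Lemma contract_linear f : linear (contract f : S -> S).
Proof.
move=> x F G; apply/mpolyP => c; rewrite mcoeffD mcoeffZ.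
pose d := maxn (msize (x *: F + G)) (maxn (msize F) (msize G)).
rewrite !(@mcoeff_contract d) ?leq_max ?leqnn ?orbT // mulr_sumr -big_split.
by apply: eq_bigr => a _; rewrite mcoeffD mcoeffZ mulrDr mulrCA.
Qed.

HB.instance Definition _ f := GRing.isLinear.Build k S S _ (contract f) (contract_linear f).

Lemma contract_ord_ge f G : ord_ge (msize G) f -> contract f G = 0.
Proof.
move=> f0; apply/mpolyP => c; rewrite (@mcoeff_contract (msize G)) // mcoeff0.
by apply: big1 => a _; rewrite f0 ?bmdeg ?mul0r.
Qed.

Lemma mcoeff_contract_psmon a G c : (contract (psmon k a) G)@_c = G@_(a + c)%MM.
Proof.
rewrite (@mcoeff_contract (msize G + mdeg a).+1) ?(leqW (leq_addr _ _)) //.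
have ad : (mdeg a < (msize G + mdeg a).+1)%N by rewrite ltnS leq_addl.
rewrite (bigD1 (BMultinom ad)) //= eqxx mul1r big1 ?addr0 // => b nb.
case: eqP => [E|_]; last by rewrite mul0r.
by case/eqP: nb; apply: val_inj.
Qed.

Lemma contract1 G : contract 1 G = G.
Proof. by rewrite -psmon0; apply/mpolyP => c; rewrite mcoeff_contract_psmon add0m. Qed.

Lemma contractM f g G : contract (f * g) G = contract f (contract g G).
Proof.
apply/mpolyP => c; pose d := maxn (msize G) (msize (contract g G)).
have Gd : (msize G <= d)%N by rewrite leq_maxl.
rewrite !(@mcoeff_contract d) ?leq_maxr //.
(* Extending the coefficient of [g] at [m - a] by 0 frees the range of [a], so that the two sums can
   be exchanged. *)
pose K (a m : 'X_{1..n}) := if (a <= m)%MM then pscoef g (m - a)%MM else 0.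
transitivity (\sum_(m : 'X_{1..n < d}) \sum_(a : 'X_{1..n < d})
    pscoef f a * (K a m * G@_(m + c)%MM)).
  apply: eq_bigr => m _; rewrite (@pscoefM _ _ d) ?bmdeg // mulr_suml big_mkcond /=.
  by apply: eq_bigr => a _; rewrite /K; case: ifP; rewrite ?mul0r ?mulr0 // mulrA.
rewrite exchange_big; apply: eq_bigr => a _; rewrite -mulr_sumr; congr (_ * _).
rewrite (mcoeff_contract _ _ Gd).
(* The Kronecker delta substitutes [m = b + a]; sums [b + a] of degree at least [d] contribute
   nothing, as [G] has no monomial there. *)
transitivity (\sum_(m : 'X_{1..n < d}) \sum_(b : 'X_{1..n < d})
    ((m : 'X_{1..n}) == (b + a)%MM)%:R * (pscoef g b * G@_(m + c)%MM)); last first.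
  rewrite exchange_big; apply: eq_bigr => b _.
  rewrite addmA; case: (ltnP (mdeg (b + a)%MM) d) => abd.
    rewrite (bigD1 (BMultinom abd)) //= eqxx mul1r big1 ?addr0 // => m nm.
    by case: eqP => [E|_]; [case/eqP: nm; apply: val_inj | rewrite mul0r].
  rewrite big1 => [|m _].
    by rewrite mcoeff_msize ?mulr0 // mdegD (leq_trans Gd) // (leq_trans abd) ?leq_addr.
  case: eqP => [E|_]; last by rewrite mul0r.
  by have := bmdeg m; rewrite E ltnNge abd.
apply: eq_bigr => m _; rewrite /K; case: ifP => am.
  have mad : (mdeg (m - a) < d)%N by rewrite (leq_ltn_trans (mdegB _ _)) ?bmdeg.
  rewrite (bigD1 (BMultinom mad)) //= submK // eqxx mul1r big1 ?addr0 // => b nb.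
  case: eqP => [E|_]; last by rewrite mul0r.
  by case/eqP: nb; apply: val_inj; rewrite /= E addmK.
rewrite mul0r big1 // => b _; case: eqP => [E|_]; last by rewrite mul0r.
by rewrite E lem_addl in am.
Qed.

Lemma contractC f g G : contract f (contract g G) = contract g (contract f G).
Proof. by rewrite -!contractM mulrC. Qed.

(** Since an ideal absorbs [psmon k c], the vanishing of f o G for all [f] in an ideal reduces to
    that of the scalars (f o G)(0). *)
Lemma mcoeff_contract0 f G c : (contract f G)@_c = (contract (psmon k c * f) G)@_0%MM.
Proof. by rewrite contractM mcoeff_contract_psmon addm0. Qed.

Lemma contract0l G : contract (0 : R) G = 0.
Proof. by rewrite -(scale0r 0) contractZl scale0r. Qed.

Lemma contractNl f G : contract (- f) G = - contract f G.
Proof. by rewrite -scaleN1r contractZl scaleN1r. Qed.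

End Contraction.

(** * Ideals as row spaces and duality *)

Section Rows.
Set Implicit Arguments.
Unset Strict Implicit.
Unset Printing Implicit Defensive.
Variables (n : nat) (k : fieldType).
Local Notation R := {mpseries k[n]}.
Local Notation S := {mpoly k[n]}.
Implicit Types (f g h : R) (F G : S) (I J K P Q : set R).

(** Among the matrices whose row space lies in [C], one of maximal rank works: a vector of [C]
    outside its row space would raise the rank. *)
Lemma subspace_row (N : nat) (C : set 'rV[k]_N) :
    C 0 -> (forall u v, C u -> C v -> C (u + v)) -> (forall c u, C u -> C (c *: u)) ->
  exists U : 'M[k]_N, forall v, C v <-> (v <= U)%MS.
Proof.
move=> C0 CD CZ; pose spans (U : 'M[k]_N) := forall v, (v <= U)%MS -> C v.
have ex : exists r, `[< exists2 U : 'M[k]_N, spans U & \rank U = r >].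
  exists 0%N; apply/asboolP; exists 0; last exact: mxrank0.
  by move=> v; rewrite submx0 => /eqP ->.
have ub r : `[< exists2 U : 'M[k]_N, spans U & \rank U = r >] -> (r <= N)%N.
  by move=> /asboolP[U _ <-]; apply: rank_leq_row.
case: (ex_maxnP ex ub) => r /asboolP[U spU rU] rmax; exists U => v; split; last exact: spU.
move=> Cv; apply: contraT => vU.
have spUv : spans (U + v)%MS.
  move=> w /sub_addsmxP[[a b] /= ->]; apply: CD; first by apply: spU; apply: submxMl.
  by rewrite [b]mx11_scalar mul_scalar_mx; apply: CZ.
have : (\rank (U + v)%MS <= r)%N by apply: rmax; apply/asboolP; exists (U + v)%MS.
rewrite leqNgt => /negP[]; rewrite -rU; apply: rank_ltmx.
by rewrite /ltmx addsmxSl addsmx_sub submx_refl (negPf vU).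
Qed.

(** * Truncation to degrees below [s] *)

Variable s : nat.
Local Notation T := 'X_{1..n < s}.
Local Notation N := #|{: T}|.

Definition low_mon (i : 'I_N) : T := enum_val i.

Definition ps_row f : 'rV[k]_N := \row_i pscoef f (low_mon i).
Definition poly_row G : 'rV[k]_N := \row_i G@_(low_mon i).
Definition row_poly (v : 'rV[k]_N) : S := \sum_i v 0 i *: 'X_[low_mon i].
Definition row_ps (v : 'rV[k]_N) : R := MPSeries (fun m => (row_poly v)@_m).

Lemma mcoeff_row_poly v i : (row_poly v)@_(low_mon i) = v 0 i.
Proof.
rewrite /row_poly raddf_sum /= (bigD1 i) //= mcoeffZ mcoeffX eqxx mulr1 big1 ?addr0 //.
move=> j ji; rewrite mcoeffZ mcoeffX; case: eqP => [E|]; last by rewrite mulr0.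
by case/eqP: ji; apply: enum_val_inj; apply: val_inj.
Qed.

Lemma msize_row_poly v : (msize (row_poly v) <= s)%N.
Proof.
rewrite msizeE; apply/bigmax_leqP_seq => m + _; rewrite mcoeff_msupp.
rewrite /row_poly raddf_sum /= leqNgt; apply: contraNN => sm; apply/eqP.
apply: big1 => i _; rewrite mcoeffZ mcoeffX; case: eqP => [E|]; last by rewrite mulr0.
by move: sm; rewrite -E ltnS leqNgt bmdeg.
Qed.

Lemma row_polyK : cancel row_poly poly_row.
Proof. by move=> v; apply/rowP => i; rewrite mxE mcoeff_row_poly. Qed.

Lemma row_psK : cancel row_ps ps_row.
Proof. by move=> v; apply/rowP => i; rewrite mxE /= mcoeff_row_poly. Qed.

Lemma poly_row_linear : linear poly_row.
Proof. by move=> c F G; apply/rowP => i; rewrite !mxE mcoeffD mcoeffZ. Qed.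

HB.instance Definition _ := GRing.isLinear.Build k S 'rV[k]_N _ poly_row poly_row_linear.

Lemma ps_row_linear : linear ps_row.
Proof. by move=> c f g; apply/rowP => i; rewrite !mxE. Qed.

HB.instance Definition _ := GRing.isLinear.Build k R 'rV[k]_N _ ps_row ps_row_linear.

Lemma row_poly_linear : linear row_poly.
Proof.
move=> c u v; rewrite /row_poly scaler_sumr -big_split; apply: eq_bigr => i _.
by rewrite !mxE scalerDl scalerA.
Qed.

HB.instance Definition _ := GRing.isLinear.Build k 'rV[k]_N S _ row_poly row_poly_linear.

Lemma poly_row_eq0 G : (msize G <= s)%N -> poly_row G = 0 -> G = 0.
Proof.
move=> Gs G0; apply/mpolyP => m; rewrite mcoeff0.
case: (ltnP (mdeg m) s) => ms; last by rewrite mcoeff_msize // (leq_trans Gs).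
have := congr1 (fun v : 'rV_N => v 0 (enum_rank (BMultinom ms))) G0.
by rewrite !mxE /low_mon enum_rankK.
Qed.

Lemma ps_row_eq0 f : ps_row f = 0 <-> ord_ge s f.
Proof.
split=> [f0 m ms|f0]; last by apply/rowP => i; rewrite !mxE f0 ?bmdeg.
have := congr1 (fun v : 'rV_N => v 0 (enum_rank (BMultinom ms))) f0.
by rewrite !mxE /low_mon enum_rankK.
Qed.

Lemma mcoeff0_contract f G : (msize G <= s)%N ->
  (contract f G)@_0%MM = (ps_row f *m (poly_row G)^T) 0 0.
Proof.
move=> Gs; rewrite (mcoeff_contract _ _ Gs) mxE.
rewrite (reindex low_mon) /=; last exact/onW_bij/enum_val_bij.
by apply: eq_bigr => i _; rewrite !mxE addm0.
Qed.

Lemma idealN P f : is_ideal P -> P f -> P (- f).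
Proof. by move=> [_ _ PM] Pf; rewrite -mulN1r; apply: PM. Qed.

Lemma idealZ P (c : k) f : is_ideal P -> P f -> P (c *: f).
Proof. by move=> [_ _ PM] Pf; rewrite scale_psE; apply: PM. Qed.

(** The row space of [U] is the image of [P] in R/m^s; the equivalence also forces m^s <= P, so the
    codimension of [P] is [N - \rank U]. *)
Definition represents (U : 'M[k]_N) P := forall f, P f <-> (ps_row f <= U)%MS.

Lemma represents_ex P : is_ideal P -> ord_ge s `<=` P -> exists U, represents U P.
Proof.
move=> idP sP; have [P0 PD PM] := idP.
have Pcong f g : ps_row f = ps_row g -> P f -> P g.
  move=> fg Pf; rewrite -[g](subrK f); apply: PD => //; apply: sP; apply/ps_row_eq0.
  by rewrite raddfB /= fg subrr.
have [|u v Cu Cv|c u Cu|U UP] := @subspace_row N [set v | P (row_ps v)].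
- by apply: (Pcong 0) => //; rewrite row_psK raddf0.
- by apply: (Pcong (row_ps u + row_ps v)); [rewrite raddfD /= !row_psK | apply: PD].
- by apply: (Pcong (c *: row_ps u)); [rewrite linearZ /= !row_psK | apply: idealZ].
exists U => f; rewrite -UP /=; split; apply: Pcong; by rewrite row_psK.
Qed.

Lemma represents_sub U V P Q : represents U P -> represents V Q -> P `<=` Q -> (U <= V)%MS.
Proof.
move=> UP VQ PQ; apply/row_subP => i; rewrite -[row i U]row_psK; apply/VQ/PQ/UP.
by rewrite row_psK row_sub.
Qed.

Lemma represents_eq U V P Q : represents U P -> represents V Q -> P `<=` Q ->
  (\rank V <= \rank U)%N -> P = Q.
Proof.
move=> UP VQ PQ rVU; apply/seteqP; split=> // f /VQ fV; apply/UP.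
apply: submx_trans fV _; have := mxrank_leqif_sup (represents_sub UP VQ PQ).
by move=> l; rewrite -(geq_leqif l).
Qed.

Lemma represents_sub_rank U V P Q : represents U P -> represents V Q -> P `<=` Q ->
  (\rank U <= \rank V)%N.
Proof. by move=> UP VQ PQ; apply/mxrankS/(represents_sub UP VQ PQ). Qed.

Lemma represents_setT U : represents U setT -> \rank U = N.
Proof.
move=> UT; apply/eqP; rewrite eqn_leq rank_leq_row /= -{1}(mxrank1 k N); apply: mxrankS.
by apply/row_subP => i; rewrite -[row i _]row_psK; apply/UT.
Qed.

Lemma perp_contract I f G : perp I G -> perp I (contract f G).
Proof. by move=> IG g /IG gG; rewrite contractC gG raddf0. Qed.

Lemma perpD I F G : perp I F -> perp I G -> perp I (F + G).
Proof. by move=> IF IG f If; rewrite raddfD /= IF // IG // addr0. Qed.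

Lemma perpZ I (c : k) G : perp I G -> perp I (c *: G).
Proof. by move=> IG f If; rewrite linearZ /= IG // scaler0. Qed.

Lemma perp0 I : perp I 0.
Proof. by move=> f _; rewrite raddf0. Qed.

(* Duality: a linear functional separating [f] from [I] is a polynomial of
   degree less than [s], and it is killed by [I] because [I] is an ideal. *)
Lemma perp_perp I f : is_ideal I -> ord_ge s `<=` I ->
  (forall G, perp I G -> contract f G = 0) -> I f.
Proof.
move=> idI sI f0; have [U UI] := represents_ex idI sI; have [_ _ IM] := idI.
apply/UI; rewrite submxE; apply/eqP/rowP => j; rewrite [RHS]mxE.
pose v := (col j (cokermx U))^T; pose G := row_poly v.
have fG g : (contract g G)@_0%MM = (ps_row g *m cokermx U) 0 j.
  by rewrite (mcoeff0_contract _ (msize_row_poly v)) row_polyK trmxK colE mulmxA -colE mxE.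
rewrite -fG f0 ?mcoeff0 // => g Ig; apply/mpolyP => c; rewrite mcoeff0 mcoeff_contract0 fG.
have : I (psmon k c * g) by apply: IM.
by move/UI; rewrite submxE => /eqP ->; rewrite mxE.
Qed.

End Rows.

(** * Codimension and length *)

Section Hankel.
Set Implicit Arguments.
Unset Strict Implicit.
Unset Printing Implicit Defensive.
Variables (n : nat) (k : fieldType).
Local Notation R := {mpseries k[n]}.
Local Notation S := {mpoly k[n]}.
Implicit Types (f g h : R) (F G : S) (I J K P Q : set R).

Lemma msize_leP d G : (forall m, (d <= mdeg m)%N -> G@_m = 0) -> (msize G <= d)%N.
Proof.
move=> G0; rewrite msizeE; apply/bigmax_leqP_seq => m + _; rewrite mcoeff_msupp ltnNge.
by apply: contraNN => /G0 ->.
Qed.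

Lemma msize_contract f G : (msize (contract f G) <= msize G)%N.
Proof.
apply: msize_leP => c Gc; rewrite (@mcoeff_contract _ _ (msize G)) // big1 // => a _.
by rewrite mcoeff_msize ?mulr0 // mdegD (leq_trans Gc) ?leq_addl.
Qed.

Lemma ann_ideal F : is_ideal (@ann n k F).
Proof.
split=> [|f g|h f] /=; rewrite /ann /=.
- exact: contract0l.
- by rewrite contractDl => -> ->; rewrite addr0.
- by rewrite contractM => ->; rewrite raddf0.
Qed.

Lemma perp_colon_ideal I F : is_ideal [set f | perp I (contract f F)].
Proof.
split=> [|f g|h f] /=; first by rewrite contract0l; apply: perp0.
  by rewrite contractDl; apply: perpD.
by rewrite contractM; apply: perp_contract.
Qed.

Lemma represents_rank s (U V : 'M[k]_#|{: 'X_{1..n < s}}|) P :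
  represents U P -> represents V P -> \rank U = \rank V.
Proof.
move=> UP VP; apply/eqP; rewrite eqn_leq.
by rewrite (represents_sub_rank UP VP) ?(represents_sub_rank VP UP).
Qed.

(* With [H] the Hankel matrix of [F], the ideals [ann F] and [K] are the kernels of
   [H] and of [H *m UI^T]; this is Macaulay duality for the form [(f g) F]. *)
Lemma perp_colon_rank s F I (UI UJ UK : 'M[k]_#|{: 'X_{1..n < s}}|) :
    (msize F <= s)%N -> is_ideal I -> ann F `<=` I ->
    represents UI I -> represents UJ (ann F) ->
    represents UK [set f | perp I (contract f F)] ->
  (\rank UK + \rank UI = #|{: 'X_{1..n < s}}| + \rank UJ)%N.
Proof.
move=> Fs [_ _ IM] JI UIP UJP UKP.
pose H := \matrix_(i, j) F@_(low_mon i + low_mon j)%MM : 'M[k]_#|{: 'X_{1..n < s}}|.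
have HT : H^T = H by apply/matrixP => i j; rewrite !mxE addmC.
have rowH f : poly_row s (contract f F) = ps_row s f *m H.
  apply/rowP => j; rewrite !mxE (mcoeff_contract _ _ Fs).
  rewrite (reindex (@low_mon n s)) /=; last exact/onW_bij/enum_val_bij.
  by apply: eq_bigr => i _; rewrite !mxE.
have size_s f : (msize (contract f F) <= s)%N := leq_trans (msize_contract f F) Fs.
have kerJ : represents (kermx H) (ann F).
  move=> f; split=> [fF|/sub_kermxP fH].
    by apply/sub_kermxP; rewrite -rowH fF raddf0.
  by apply: (poly_row_eq0 (size_s f)); rewrite rowH.
have kerK : represents (kermx (H *m UI^T)) [set f | perp I (contract f F)].
  have pair0 f g : (contract g (contract f F))@_0%MM = (ps_row s f *m H *m (ps_row s g)^T) 0 0.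
    rewrite (mcoeff0_contract _ (size_s f)) rowH -[ps_row s g in LHS]trmxK.
    by rewrite -trmx_mul mxE.
  move=> f; split=> [fI|/sub_kermxP fH g /[dup] Ig].
    apply/sub_kermxP/rowP => j; rewrite mulmxA [RHS]mxE.
    have -> : (ps_row s f *m H *m UI^T) 0 j = (contract (row_ps (row j UI)) (contract f F))@_0%MM.
      by rewrite pair0 row_psK tr_row colE mulmxA -colE [RHS]mxE.
    have Irow : I (row_ps (row j UI)) by apply/UIP; rewrite row_psK row_sub.
    by rewrite (fI _ Irow) mcoeff0.
  move=> _; apply/mpolyP => c; rewrite mcoeff0 mcoeff_contract0 pair0.
  have /UIP/submxP[D ->] : I (psmon k c * g) by apply: IM.
  by rewrite trmx_mul mulmxA -(mulmxA (ps_row s f)) fH mul0mx mxE.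
(* As [H] is symmetric, [H *m UI^T] has the rank of [UI *m H], which is the rank of [UI] minus that
   of its intersection with the kernel of [H]. That kernel is [ann F], contained in [I], so the
   intersection is all of it. *)
rewrite (represents_rank UKP kerK) (represents_rank UJP kerJ) mxrank_ker.
have -> : \rank (H *m UI^T) = \rank (UI *m H) by rewrite -mxrank_tr trmx_mul trmxK HT.
rewrite -(mxrank_mul_ker UI H) addnA subnK ?rank_leq_col //; congr (_ + _)%N.
by apply: eqmx_rank; rewrite capmxSr sub_capmx submx_refl (represents_sub kerJ UIP).
Qed.

Lemma represents_ord_ge s U P : @represents n k s U P -> ord_ge s `<=` P.
Proof. by move=> UP f /ps_row_eq0 f0; apply/UP; rewrite f0 sub0mx. Qed.

Lemma ideal_setT P : is_ideal P -> P 1 -> P = setT.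
Proof. by move=> [_ _ PM] P1; apply/seteqP; split=> // f _; rewrite -[f]mulr1; apply: PM. Qed.

Lemma proper_ideal_sub P : is_ideal P -> ~ P 1 -> P `<=` ord_ge 1.
Proof.
move=> [_ _ PM] P1 f Pf; apply/ord_ge1; apply/eqP; apply: contraT => /unit_ps[g gf].
by case: P1; rewrite -gf; apply: PM.
Qed.

(** * Chains of ideals and codimension *)

Section Length.
Variable s : nat.
Local Notation N := #|{: 'X_{1..n < s}}|.
Implicit Types (U V : 'M[k]_N).

(* Take [t] outside [P] with maximal order of vanishing. *)
Lemma ideal_socle P U : represents U P -> ~ P 1 ->
  exists2 t, ~ P t & forall g, ord_ge 1 g -> P (g * t).
Proof.
move=> UP P1; have sP := represents_ord_ge UP.
have ex : exists j, `[< exists2 t, ord_ge j t & ~ P t >].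
  by exists 0%N; apply/asboolP; exists 1.
have ub j : `[< exists2 t, ord_ge j t & ~ P t >] -> (j <= s)%N.
  move=> /asboolP[t tj Pt]; rewrite leqNgt; apply/negP => sj; apply: Pt; apply: sP.
  exact: ord_ge_leq (ltnW sj) tj.
case: (ex_maxnP ex ub) => j /asboolP[t tj Pt] jmax; exists t => // g g1.
apply: contrapT => Pgt; have := jmax j.+1; rewrite ltnn => H.
by apply: notF; apply: H; apply/asboolP; exists (g * t) => //; rewrite -add1n; apply: ord_geM.
Qed.

(** The subspace P + k t. If m t <= P, it is the ideal P + R t, because R = k + m. *)
Definition adjoin P t : set R := [set f | exists c : k, P (f - c *: t)].

Lemma sub_adjoin P t : P `<=` adjoin P t.
Proof. by move=> f Pf; exists 0; rewrite scale0r subr0. Qed.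

Lemma adjoin_ideal P t : is_ideal P -> (forall g, ord_ge 1 g -> P (g * t)) ->
  is_ideal (adjoin P t).
Proof.
move=> idP Pmt; have [P0 PD PM] := idP; split=> [|f g [c fc] [d gd]|h f [c fc]].
- exact: sub_adjoin.
- by exists (c + d); rewrite scalerDl opprD addrACA; apply: PD.
have [h1 [h11 Eh]] := psD0 h; exists (pscoef h 0%MM * c).
have -> : h * f - (pscoef h 0%MM * c) *: t = h * (f - c *: t) + c *: (h1 * t).
  rewrite -scalerA (scale_psE _ (c *: t)) (scale_psE _ (h1 * t)) (scale_psE c t).
  have Ea : pscoef h 0%MM *: (1 : R) = h - h1 by rewrite {2}Eh addrK.
  by rewrite Ea; ring.
by apply: PD; [apply: PM | apply: idealZ => //; apply: Pmt].
Qed.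

Lemma represents_adjoin P U t : represents U P -> ~ P t ->
  exists2 V : 'M[k]_N, represents V (adjoin P t) & \rank V = (\rank U).+1.
Proof.
move=> UP Pt; exists (U + ps_row s t)%MS.
  move=> f; split=> [[c /UP fc]|/sub_addsmxP[[a b] /= E]].
    rewrite -[f](subrK (c *: t)) raddfD /= addmx_sub_adds // linearZ /=.
    exact: scalemx_sub.
  exists (b 0 0); apply/UP; rewrite raddfB /= linearZ /= E {1}[b]mx11_scalar mul_scalar_mx.
  by rewrite addrK submxMl.
apply/eqP; rewrite eqn_leq; apply/andP; split.
  by rewrite (leq_trans (mxrank_adds_leqif _ _)) // -[leqRHS]addn1 leq_add2l rank_leq_row.
apply: rank_ltmx; rewrite /ltmx addsmxSl addsmx_sub submx_refl /=.
by apply/negP => /UP.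
Qed.

(** Adjoining a socle element raises the dimension by exactly one; repeated up to the whole ring,
    this gives a chain as long as the codimension. *)
Lemma ideal_chain_ex d P U : is_ideal P -> represents U P -> (\rank U + d = N)%N ->
  exists J : nat -> set R, J 0%N = P /\ ideal_chain d J.
Proof.
elim: d P U => [|d IH] P U idP UP Ud; first by exists (fun=> P).
have P1 : ~ P 1.
  move=> /(ideal_setT idP) PT; rewrite PT in UP.
  by move: Ud; rewrite (represents_setT UP) -[RHS]addn0 => /addnI.
have [t Pt Pmt] := ideal_socle UP P1; have idQ := adjoin_ideal idP Pmt.
have [V VQ rV] := represents_adjoin UP Pt; have PQ := @sub_adjoin P t.
have [|J [J0 [Jid Jlt]]] := IH _ V idQ VQ; first by rewrite rV addSnnS.
exists (fun i => if i is i'.+1 then J i' else P); split=> //; split=> [[|i]|[|i]] //.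
  exact: Jid.
  move=> _; rewrite J0; split=> // QP.
  by have := represents_sub_rank VQ UP QP; rewrite rV ltnn.
by move=> id; apply: Jlt.
Qed.

Lemma ideal_chain_rank l (J : nat -> set R) U : represents U (J 0%N) -> ideal_chain l J ->
  (\rank U + l <= N)%N.
Proof.
move=> UJ [Jid Jlt].
suff H i : (i <= l)%N -> exists2 V : 'M[k]_N, represents V (J i) & (\rank U + i <= \rank V)%N.
  by have [V _ /leq_trans] := H l (leqnn l); apply; apply: rank_leq_row.
elim: i => [_|i IH il]; first by exists U; rewrite ?addn0.
have [V VJ rV] := IH (ltnW il); have [JS nJS] := Jlt _ il.
have [W WJ] := represents_ex (Jid _ il) (subset_trans (represents_ord_ge VJ) JS).
exists W => //; rewrite addnS; apply: leq_ltn_trans rV _; rewrite ltnNge; apply/negP => WV.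
by apply: nJS; rewrite (represents_eq VJ WJ JS WV).
Qed.

End Length.

(** * Quotients of the power series ring, presented by a surjection with kernel [I] *)

Section Quotient.
Variables (A : comNzRingType) (p : {rmorphism R -> A}) (I : set R).
Hypothesis p_surj : forall a, exists f, p f = a.
Hypothesis p_ker : forall f, p f = 0 <-> I f.

Lemma kernel_ideal : is_ideal I.
Proof.
split=> [|f g /p_ker f0 /p_ker g0|h f /p_ker f0]; apply/p_ker; first exact: rmorph0.
  by rewrite rmorphD f0 g0 addr0.
by rewrite rmorphM f0 mulr0.
Qed.

Lemma preimage_ideal (J : set A) : is_ideal J -> is_ideal (p @^-1` J) /\ I `<=` p @^-1` J.
Proof.
move=> [J0 JD JM]; split=> [|f /p_ker f0]; last by rewrite /preimage /= f0.
split=> [|f g|h f]; rewrite /preimage /=; first by rewrite rmorph0.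
  by rewrite rmorphD; apply: JD.
by rewrite rmorphM; apply: JM.
Qed.

Lemma image_ideal P : is_ideal P -> is_ideal (p @` P).
Proof.
move=> [P0 PD PM]; split=> [|_ _ [f Pf <-] [g Pg <-]|c _ [f Pf <-]].
- by exists 0; rewrite ?rmorph0.
- by exists (f + g); rewrite ?rmorphD //; apply: PD.
by have [h <-] := p_surj c; exists (h * f); rewrite ?rmorphM //; apply: PM.
Qed.

Lemma image_memE P f : is_ideal P -> I `<=` P -> (p @` P) (p f) -> P f.
Proof.
move=> [_ PD _] IP [g Pg gf]; rewrite -[f](subrK g); apply: PD => //; apply: IP.
by apply/p_ker; rewrite rmorphB gf subrr.
Qed.

Lemma preimage_inj (J J' : set A) : p @^-1` J `<=` p @^-1` J' -> J `<=` J'.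
Proof.
move=> JJ a Ja; have [f fa] := p_surj a; rewrite -fa.
by apply: JJ; rewrite /preimage /= fa.
Qed.

Lemma has_length_rank s (U : 'M[k]_#|{: 'X_{1..n < s}}|) : represents U I ->
  has_length A (#|{: 'X_{1..n < s}}| - \rank U).
Proof.
move=> UI; split=> [|l J [Jid Jlt]].
  have [|J [J0 [Jid Jlt]]] := ideal_chain_ex (d := #|{: 'X_{1..n < s}}| - \rank U) kernel_ideal UI.
    by rewrite subnKC ?rank_leq_row.
  have IJ i : (i <= #|{: 'X_{1..n < s}}| - \rank U)%N -> I `<=` J i.
    elim: i => [|i IH] il; first by rewrite J0.
    by apply: subset_trans (IH (ltnW il)) _; case: (Jlt _ il).
  exists (fun i => p @` J i); split=> i il; first exact/image_ideal/Jid.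
  have [JS nJS] := Jlt _ il; split=> [|H]; first exact: image_subset.
  apply: nJS => f Jf; apply: image_memE; [exact/Jid/ltnW | exact/IJ/ltnW |].
  by apply: H; exists f.
have [idJ0 IJ0] := preimage_ideal (Jid 0%N isT).
have [V VJ] := represents_ex idJ0 (subset_trans (represents_ord_ge UI) IJ0).
have Jch : ideal_chain l (fun i => p @^-1` J i).
  split=> i il; first exact: (preimage_ideal (Jid i il)).1.
  have [JS nJS] := Jlt _ il; split=> [f|H]; first exact: JS.
  by apply: nJS; apply: preimage_inj H.
have := ideal_chain_rank VJ Jch; rewrite leq_subRL ?rank_leq_row //; apply: leq_trans.
by rewrite leq_add2r (represents_sub_rank UI VJ).
Qed.

(** The images of the powers of m stabilise, so an element of m^s agrees modulo [I] with one of
    m^(s+1), which is the hypothesis of Nakayama's lemma. *)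
Lemma artinian_ord_ge : artinian A -> exists s, ord_ge s `<=` I.
Proof.
move=> artA; have [|i|s Js] := artA (fun i => p @` ord_ge i).
- by move=> i; apply/image_ideal/ord_ge_ideal.
- by apply: image_subset => f; apply: ord_ge_leq.
exists s; apply: nakayama_ord_ge kernel_ideal _ => f fs.
have : (p @` ord_ge s) (p f) by exists f.
rewrite -(Js s.+1) // => -[g g1 gf]; exists (f - g); last by rewrite opprB addrC subrK.
by apply/p_ker; rewrite rmorphB gf subrr.
Qed.

(** Preimages of ideals are row spaces in R/m^s, so a descending chain stops at a member of least
    rank. *)
Lemma ord_ge_artinian s : ord_ge s `<=` I -> artinian A.
Proof.
move=> sI J Jid Jdec.
have rep i : exists U : 'M[k]_#|{: 'X_{1..n < s}}|, represents U (p @^-1` J i).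
  have [id1 IJ] := preimage_ideal (Jid i).
  by apply: represents_ex => //; apply: subset_trans IJ.
have /choice[U UP] := rep.
have ex : exists r, `[< exists i, \rank (U i) = r >].
  by exists (\rank (U 0%N)); apply/asboolP; exists 0%N.
case: (ex_minnP ex) => _ /asboolP[N0 <-] rmin; exists N0 => i Ni.
have Jsub : J i `<=` J N0.
  rewrite -(subnKC Ni); elim: (i - N0)%N => [|d IH]; first by rewrite addn0.
  by rewrite addnS; apply: subset_trans (Jdec _) IH.
have E : p @^-1` J i = p @^-1` J N0.
  apply: (represents_eq (UP i) (UP N0)); first by move=> f; apply: Jsub.
  by apply: rmin; apply/asboolP; exists i.
by apply/seteqP; split=> //; apply: preimage_inj; rewrite E.
Qed.

Hypothesis I1 : ~ I 1.

Lemma quot_local : is_local (p @` ord_ge 1).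
Proof.
have Isub := proper_ideal_sub kernel_ideal I1.
have sub (J : set A) : is_ideal J -> ~ J 1 -> J `<=` p @` ord_ge 1.
  move=> idJ J1 a Ja; have [f fa] := p_surj a; exists f => //.
  apply: (proper_ideal_sub (preimage_ideal idJ).1); rewrite /preimage /= ?rmorph1 //.
  by rewrite fa.
have JT (J : set A) : is_ideal J -> J 1 -> J = setT.
  by move=> [_ _ JM] J1; apply/seteqP; split=> // a _; rewrite -[a]mulr1; apply: JM.
have n1 : ~ (p @` ord_ge 1) 1.
  rewrite -(rmorph1 p) => /(image_memE (ord_ge_ideal _ _ _) Isub)/ord_ge1/eqP.
  by rewrite pscoef1 eqxx oner_eq0.
have idm : is_ideal (p @` ord_ge 1) by apply/image_ideal/ord_ge_ideal.
split=> [|m' [idm' m'1 m'max]].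
  split=> // J idJ mJ; have [J1|J1] := pselect (J 1); first by right; apply: JT.
  by left; apply/seteqP; split=> //; apply: sub.
have [//|mT] := m'max _ idm (sub _ idm' m'1).
by case: n1; rewrite mT.
Qed.

End Quotient.

(** The leading monomial has maximal degree, so contraction by it leaves only the leading
    coefficient. *)
Lemma contract_eq1 F : F != 0 -> exists f, contract f F = 1.
Proof.
move=> F0; exists ((mleadc F)^-1 *: psmon k (mlead F)).
apply/mpolyP => c; rewrite contractZl mcoeffZ mcoeff_contract_psmon mcoeff1.
have [->|c0] := eqVneq c 0%MM; first by rewrite addm0 mulVf ?mleadc_eq0.
rewrite (mcoeff_msize (m := (mlead F + c)%MM)) ?mulr0 // -(mlead_deg F0).
by rewrite mdegD -addn1 leq_add2l lt0n mdeg_eq0.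
Qed.

(** A class [f] lies in the socle iff m kills f o F, that is, iff f o F is constant; the socle is
    therefore the line through [f0] with f0 o F = 1. *)
Lemma gorenstein_ann (A : comNzRingType) (p : {rmorphism R -> A}) F :
    (forall a, exists f, p f = a) -> (forall f, p f = 0 <-> ann F f) -> F != 0 ->
  artin_gorenstein_local (p @` ord_ge 1).
Proof.
move=> p_surj p_ker F0; have [f0 f0F] := contract_eq1 F0; split.
- by apply: quot_local p_surj p_ker _; rewrite /ann /= contract1; apply/eqP.
- by apply: (ord_ge_artinian p_surj p_ker (s := msize F)) => f; apply: contract_ord_ge.
exists (p f0); split=> [_ [g g1 <-]||t soct].
- rewrite -rmorphM; apply/p_ker; rewrite /ann /= mulrC contractM f0F.
  by apply: contract_ord_ge; rewrite msize1.
- by apply/eqP => /p_ker; rewrite /ann /= f0F => /eqP; rewrite oner_eq0.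
have [f ft] := p_surj t; set c := (contract f F)@_0%MM.
exists (p (c *: (1 : R))); rewrite -ft -rmorphM -scale_psE; apply/eqP; rewrite -subr_eq0 -rmorphB.
apply/eqP/p_ker; rewrite /ann /= contractDl contractNl contractZl f0F.
apply/mpolyP => m; rewrite mcoeffB mcoeffZ mcoeff1 mcoeff0.
have [->|m0] := eqVneq m 0%MM; first by rewrite mulr1 subrr.
rewrite mulr0 subr0 mcoeff_contract0.
suff /p_ker : p (psmon k m * f) = 0 by rewrite /ann /= => ->; rewrite mcoeff0.
rewrite rmorphM mulrC ft; apply: soct; exists (psmon k m) => //.
by apply: (@ord_ge_leq _ _ 1 (mdeg m)); [rewrite lt0n mdeg_eq0 | apply: ord_ge_psmon].
Qed.

End Hankel.

(** * Gorenstein covers *)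

Section Covers.
Set Implicit Arguments.
Unset Strict Implicit.
Unset Printing Implicit Defensive.

Lemma factor_morph (R G A : comNzRingType) (p : {rmorphism R -> G}) (q : {rmorphism R -> A}) :
    (forall g, exists f, p f = g) -> (forall f, p f = 0 -> q f = 0) ->
  exists phi : {rmorphism G -> A}, forall f, phi (p f) = q f.
Proof.
move=> /choice[r rP] pq; pose phi g := q (r g).
have phiE f : phi (p f) = q f.
  by apply/eqP; rewrite -subr_eq0 -rmorphB; apply/eqP/pq; rewrite rmorphB rP subrr.
have phiB : zmod_morphism phi.
  by move=> x y; rewrite -[x]rP -[y]rP -rmorphB !phiE rmorphB.
have phiM : monoid_morphism phi.
  split=> [|x y]; first by rewrite -(rmorph1 p) phiE rmorph1.
  by rewrite -[x]rP -[y]rP -rmorphM !phiE rmorphM.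
pose phi' : {rmorphism G -> A} := HB.pack phi
  (GRing.isZmodMorphism.Build _ _ phi phiB) (GRing.isMonoidMorphism.Build _ _ phi phiM).
by exists phi'.
Qed.

Lemma ideal_quot_morph (R : comNzRingType) (I : idealr R) :
  exists p : {rmorphism R -> {ideal_quot I}},
    (forall a, exists f, p f = a) /\ (forall f, p f = 0 <-> [set` I] f).
Proof.
exists (\pi_({ideal_quot I})%qT : {rmorphism R -> {ideal_quot I}}); split=> [a|f].
  by exists (repr a); rewrite /= reprK.
rewrite /mkset -[f in f \in I]subr0 Quotient.idealrBE.
by rewrite -(rmorph0 (\pi_({ideal_quot I})%qT)); apply: (rwP eqP).
Qed.

Lemma idealr_of_ideal (R : comNzRingType) (P : set R) : is_ideal P -> ~ P 1 ->
  exists J : idealr R, [set` J] = P.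
Proof.
move=> [P0 PD PM] P1; pose S : R -> bool := fun f => `[< P f >].
have idS : idealr_closed S.
  split=> [||a f g]; rewrite /in_mem /= /S; first exact/asboolP.
    by apply/negP => /asboolP.
  by move=> /asboolP Pf /asboolP Pg; apply/asboolP/PD => //; apply: PM.
pose J : idealr R := HB.pack S (isIdealr.Build R S idS).
by exists J; apply/seteqP; split=> f /asboolP.
Qed.

Lemma has_length_inj (A : comNzRingType) l l' : has_length A l -> has_length A l' -> l = l'.
Proof.
move=> [[J Jl] lmax] [[J' Jl'] lmax']; apply/eqP; rewrite eqn_leq.
by rewrite (lmax' _ _ Jl) (lmax _ _ Jl').
Qed.

Variables (n : nat) (k : fieldType).
Local Notation R := {mpseries k[n]}.
Local Notation S := {mpoly k[n]}.

Lemma idealr_is_ideal (I : idealr R) : is_ideal [set` I].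
Proof.
split=> [|f g|h f]; rewrite /mkset; [exact: rpred0 | exact: rpredD | exact: idealMr].
Qed.

Lemma idealr_not1 (I : idealr R) : ~ [set` I] 1.
Proof. by rewrite /mkset idealr1. Qed.

Variables (I J : idealr R) (F : S) (sI : nat).
Hypothesis sub_I : ord_ge sI `<=` [set` I].
Hypothesis J_ann : [set` J] = ann F.
Hypothesis perp_F : perp [set` I] `<=` cyclic_submod F.
Local Notation K := [set f | perp [set` I] (contract f F)].
Local Notation s := (msize F).
Local Notation N := #|{: 'X_{1..n < s}}|.

Lemma ann_sub_I : ann F `<=` [set` I].
Proof.
move=> f fF; apply: perp_perp (idealr_is_ideal I) sub_I _ => G /perp_F[g _ <-].
by rewrite contractC fF raddf0.
Qed.

Lemma gen_neq0 : F != 0.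
Proof.
by apply/eqP => F0; apply: (@idealr_not1 J); rewrite J_ann /ann /= F0 raddf0.
Qed.

Lemma ord_ge_ann : ord_ge s `<=` ann F.
Proof. by move=> f; apply: contract_ord_ge. Qed.

Lemma ann_sub_colon : ann F `<=` K.
Proof. by move=> f /= ->; apply: perp0. Qed.

Lemma colon_represents : exists U : 'M[k]_N, represents U K.
Proof.
apply: represents_ex; first exact: perp_colon_ideal.
exact: subset_trans ord_ge_ann ann_sub_colon.
Qed.

(** The two lengths are [N - \rank UJ] and [N - \rank UI]; [perp_colon_rank] converts their
    difference into the codimension of [K]. *)
Lemma cover_colengthE (U : 'M[k]_N) c : represents U K ->
  cover_colength I J c <-> (\rank U + c = N)%N.
Proof.
move=> UK; have sJ : ord_ge s `<=` [set` J] by rewrite J_ann; apply: ord_ge_ann.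
have [UI UIP] := represents_ex (idealr_is_ideal I) (subset_trans ord_ge_ann ann_sub_I).
have [UJ UJP] := represents_ex (idealr_is_ideal J) sJ.
have [pI [pI_surj pI_ker]] := ideal_quot_morph I.
have [pJ [pJ_surj pJ_ker]] := ideal_quot_morph J.
have lI := has_length_rank pI_surj pI_ker UIP.
have lJ := has_length_rank pJ_surj pJ_ker UJP.
have UJP' := UJP; rewrite J_ann in UJP'.
have := perp_colon_rank (leqnn _) (idealr_is_ideal I) ann_sub_I UIP UJP' UK.
have rI := rank_leq_row UI; have rJ := rank_leq_row UJ => rK; split.
  by move=> [lG [lA [/(has_length_inj lJ) <- /(has_length_inj lI) <-]]]; lia.
by move=> rc; exists (N - \rank UJ)%N, (N - \rank UI)%N; split=> //; lia.
Qed.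

Lemma cover_colength0 : cover_colength I J 0 -> gorenstein {ideal_quot I}.
Proof.
have [U UK] := colon_represents; move/(cover_colengthE _ UK); rewrite addn0 => rU.
have KT : K = setT.
  have [V VT] : exists V : 'M[k]_N, represents V setT by apply: represents_ex.
  by apply: (represents_eq UK VT) => //; rewrite rU rank_leq_row.
have F_perp : perp [set` I] F by rewrite -[F]contract1 -/(K 1) KT.
have I_ann : [set` I] = ann F.
  by apply/seteqP; split; [move=> f /F_perp | apply: ann_sub_I].
have [p [p_surj p_ker]] := ideal_quot_morph I; rewrite I_ann in p_ker.
by exists (p @` ord_ge 1); apply: gorenstein_ann p_surj p_ker gen_neq0.
Qed.

Lemma cover_colength1 : cover_colength I J 1 -> teter {ideal_quot I}.
Proof.
have [U UK] := colon_represents; move/(cover_colengthE _ UK); rewrite addn1 => rU.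
have idK : is_ideal K by apply: perp_colon_ideal.
have K1 : ~ K 1.
  move=> /(ideal_setT idK) KT; rewrite KT in UK.
  by move: rU; rewrite (represents_setT UK) => /eqP; rewrite eqn_leq ltnn.
have KM : K = ord_ge 1.
  have s1 : (0 < s)%N by rewrite -(mlead_deg gen_neq0).
  have [V VM] : exists V : 'M[k]_N, represents V (ord_ge 1).
    by apply: represents_ex; [apply: ord_ge_ideal | move=> f; apply: ord_ge_leq].
  apply: (represents_eq UK VM); first exact: proper_ideal_sub.
  (* [K] has codimension 1 and lies in m, so equality follows once m is not the whole space. *)
  rewrite -ltnS rU ltn_neqAle rank_leq_row andbT; apply/eqP => rV.
  have /VM/ord_ge1/eqP : (ps_row s (1 : R) <= V)%MS.
    by rewrite submx_full // /row_full rV.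
  by rewrite pscoef1 eqxx oner_eq0.
have [p [p_surj p_ker]] := ideal_quot_morph J; have [q [q_surj q_ker]] := ideal_quot_morph I.
have p_ker' := p_ker; rewrite J_ann in p_ker'.
have [|phi phiE] := @factor_morph _ _ _ p q p_surj.
  by move=> f /p_ker' /ann_sub_I /q_ker.
exists {ideal_quot J}, (p @` ord_ge 1), phi; split=> [|a|g].
- exact: gorenstein_ann p_surj p_ker' gen_neq0.
- by have [f <-] := q_surj a; exists (p f); rewrite phiE.
(* Now I^perp = m o F. An [f] in [I] kills m o F, so f m <= Ann F; conversely, an [f] with f m <=
   Ann F kills I^perp and lies in [I] by biduality. *)
have [f <-] := p_surj g; rewrite phiE; split=> [/q_ker If _ [h h1 <-]|soc_f].
  rewrite -rmorphM; apply/p_ker'; rewrite /ann /= contractM.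
  by rewrite -KM in h1; apply: h1.
apply/q_ker; apply: perp_perp (idealr_is_ideal I) sub_I _ => G IG.
have [h _ hG] := perp_F IG; have h1 : ord_ge 1 h by rewrite -KM /= hG.
rewrite -hG -contractM; apply/p_ker'; rewrite rmorphM; apply: soc_f.
by exists h.
Qed.

End Covers.

(** * Ideals of colength two *)

Section LinearForms.
Set Implicit Arguments.
Unset Strict Implicit.
Unset Printing Implicit Defensive.

Section Span.
Variable A : comNzRingType.
Implicit Types (S P J : set A).

Lemma ideal_span_ideal S : is_ideal (ideal_span S).
Proof.
split=> [|_ _ [r [c [u [Su ->]]]] [r' [c' [u' [Su' ->]]]]|d _ [r [c [u [Su ->]]]]].
- by exists 0%N, (fun=> 0), (fun=> 0); split=> [[]|] //; rewrite big_ord0.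
- exists (r + r')%N, (fun i => match split i with inl j => c j | inr j => c' j end),
    (fun i => match split i with inl j => u j | inr j => u' j end).
  split=> [i|]; first by case: (split i).
  rewrite big_split_ord; congr (_ + _); apply: eq_bigr => i _.
    by case: split_ordP => j /eqP; rewrite eq_shift // => /eqP ->.
  by case: split_ordP => j /eqP; rewrite eq_shift // => /eqP ->.
exists r, (fun i => d * c i), u; split=> //.
by rewrite mulr_sumr; apply: eq_bigr => i _; rewrite mulrA.
Qed.

Lemma sub_ideal_span S : S `<=` ideal_span S.
Proof.
by move=> a Sa; exists 1%N, (fun=> 1), (fun=> a); split=> //; rewrite big_ord1 mul1r.
Qed.

Lemma ideal_span_sub S P : is_ideal P -> S `<=` P -> ideal_span S `<=` P.
Proof.
move=> [P0 PD PM] SP _ [r [c [u [Su ->]]]].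
by elim/big_ind: _ => // i _; apply/PM/SP.
Qed.

Lemma ideal_sum P (T : finType) (r : pred T) (u : T -> A) :
  is_ideal P -> (forall t, r t -> P (u t)) -> P (\sum_(t | r t) u t).
Proof. by move=> [P0 PD PM] Pu; elim/big_ind: _. Qed.

End Span.

Variables (n : nat) (k : fieldType).
Local Notation R := {mpseries k[n]}.
Implicit Types (f g h : R) (P K : set R).

Definition lin_form (v : 'rV[k]_n) : R := \sum_i v 0 i *: psX k i.

Lemma lin_form_linear : linear lin_form.
Proof.
move=> c u v; rewrite /lin_form scaler_sumr -big_split; apply: eq_bigr => i _.
by rewrite !mxE scalerDl scalerA.
Qed.

HB.instance Definition _ := GRing.isLinear.Build k 'rV[k]_n R _ lin_form lin_form_linear.

Lemma pscoef_lin_form v a : pscoef (lin_form v) a = \sum_i v 0 i * (a == U_(i)%MM)%:R.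
Proof. by rewrite pscoef_sum. Qed.

Lemma pscoef_lin_formU v i : pscoef (lin_form v) U_(i)%MM = v 0 i.
Proof.
rewrite pscoef_lin_form (bigD1 i) //= eqxx mulr1 big1 ?addr0 // => j ji.
case: eqP => [/mnmP/(_ j)|_]; last by rewrite mulr0.
by rewrite !mnm1E eqxx [i == j]eq_sym (negPf ji).
Qed.

Lemma is_linear_lin_form v : is_linear_form (lin_form v).
Proof.
move=> a; apply: contra_neq_eq => a1; rewrite pscoef_lin_form big1 // => i _.
by case: eqP => [E|_]; [rewrite E mdeg1 in a1 | rewrite mulr0].
Qed.

Lemma linear_formE f : is_linear_form f -> f = lin_form (\row_i pscoef f U_(i)%MM).
Proof.
move=> lf; apply: pscoefP => a; have [/mdeg1P[i /eqP ->]|a1] := boolP (mdeg a == 1%N).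
  by rewrite pscoef_lin_formU mxE.
transitivity (0 : k); first by apply/eqP; apply: contraNT a1 => /lf ->.
by apply/esym/eqP; apply: contraNT a1 => /(@is_linear_lin_form _ _) ->.
Qed.

Lemma ord_ge_lin_form v : ord_ge 1 (lin_form v).
Proof.
have id1 := @ord_ge_ideal n k 1.
by apply: (ideal_sum id1) => i _; apply: (idealZ _ id1); apply: ord_ge_psX.
Qed.

Lemma psX_lin_form i : psX k i = lin_form (delta_mx 0 i).
Proof.
rewrite /lin_form (bigD1 i) //= mxE !eqxx scale1r big1 ?addr0 // => j ji.
by rewrite mxE (negPf ji) andbF scale0r.
Qed.

Lemma ord_ge_lin f : ord_ge 1 f -> exists v (h : 'I_n -> R),
  (forall i, ord_ge 1 (h i)) /\ f = lin_form v + \sum_i psX k i * h i.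
Proof.
move=> /ord_ge_decomp[g [_ ->]]; have /choice[h hP] i := psD0 (g i).
exists (\row_i pscoef (g i) 0%MM), h; split=> [i|]; first exact: (hP i).1.
rewrite /lin_form -big_split; apply: eq_bigr => i _ /=.
by rewrite mxE {1}(hP i).2 mulrDr [_ *: psX k i]scale_psE [psX k i * (_ *: _)]mulrC.
Qed.

Lemma ord_ge_decomp2 d f : ord_ge d.+2 f -> exists h : 'I_n -> 'I_n -> R,
  (forall i j, ord_ge d (h i j)) /\ f = \sum_i \sum_j psX k i * psX k j * h i j.
Proof.
move=> /ord_ge_decomp[g [gd ->]].
have /choice[h hP] i := ord_ge_decomp (gd i).
exists h; split=> [i|]; first exact: (hP i).1.
apply: eq_bigr => i _; rewrite {1}(hP i).2 mulr_sumr.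
by apply: eq_bigr => j _; rewrite mulrA.
Qed.

(** * The ideal of independent linear forms with the last one squared *)

Section Independent.
Variable L : 'I_n -> R.
Hypothesis L_lin : forall i, is_linear_form (L i).
Hypothesis L_ind : independent_forms L.
Local Notation Q := (last_squared_ideal L).

(** Independence makes the coefficient matrix row free; being square, it is invertible. *)
Lemma independent_forms_span v : exists d : 'I_n -> k, lin_form v = \sum_i d i *: L i.
Proof.
pose M := \matrix_(i, j) pscoef (L i) U_(j)%MM.
have LE i : L i = lin_form (row i M).
  rewrite {1}(linear_formE (@L_lin i)); congr lin_form.
  by apply/rowP => j; rewrite !mxE.
have sumE (d : 'rV[k]_n) : \sum_i d 0 i *: L i = lin_form (d *m M).
  rewrite mulmx_sum_row raddf_sum; apply: eq_bigr => i _.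
  by rewrite /= linearZ /= LE.
have M_free : row_free M.
  rewrite -kermx_eq0; apply/eqP/row_matrixP => i; rewrite row0; apply/rowP => j; rewrite [RHS]mxE.
  apply: L_ind; rewrite sumE; suff -> : row i (kermx M) *m M = 0 by rewrite raddf0.
  by apply/sub_kermxP; rewrite row_sub.
have /submxP[d ->] : (v <= M)%MS by rewrite submx_full // row_full_unit -row_free_unit.
by exists (d 0); rewrite sumE.
Qed.

Lemma last_squared_mem (i : 'I_n) : i.+1 != n -> Q (L i).
Proof. by move=> /negPf i_n; apply: sub_ideal_span; exists i => //; rewrite i_n. Qed.

(** Either one factor is a generator, or both are the last form and the product is its square. *)
Lemma last_squared_mem2 i j : Q (L i * L j).
Proof.
have [_ _ QM] := ideal_span_ideal [set (if (i : 'I_n).+1 == n then L i ^+ 2 else L i) | i in setT].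
have [i_n|i_n] := eqVneq i.+1 n; last by rewrite mulrC; apply/QM/last_squared_mem.
have [j_n|j_n] := eqVneq j.+1 n; last by apply/QM/last_squared_mem.
have -> : j = i by apply/val_inj/succn_inj; rewrite i_n j_n.
by apply: sub_ideal_span; exists i => //; rewrite i_n eqxx expr2.
Qed.

Lemma last_squared_is_ideal : is_ideal Q.
Proof. exact: ideal_span_ideal. Qed.

Lemma last_squared_psX i j : Q (psX k i * psX k j).
Proof.
have idQ := last_squared_is_ideal; have [_ _ QM] := idQ.
rewrite !psX_lin_form; have [c ->] := independent_forms_span (delta_mx 0 i).
have [d ->] := independent_forms_span (delta_mx 0 j).
rewrite mulr_suml; apply: ideal_sum => // i' _; rewrite mulr_sumr.
apply: ideal_sum => // j' _; rewrite scale_psE [d j' *: _]scale_psE mulrACA.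
exact/QM/last_squared_mem2.
Qed.

Lemma last_squared_ord2 f : ord_ge 2 f -> Q f.
Proof.
have idQ := last_squared_is_ideal; have [_ _ QM] := idQ.
move=> /ord_ge_decomp2[h [_ ->]]; apply: ideal_sum => // i _; apply: ideal_sum => // j _.
by rewrite mulrC; apply/QM/last_squared_psX.
Qed.

Lemma ord_ge_lin_last f : ord_ge 1 f -> exists v, Q (f - lin_form v).
Proof.
move=> /ord_ge_lin[v [h [h1 ->]]]; exists v; rewrite addrC addKr.
apply: ideal_sum (last_squared_is_ideal) _ => i _; apply: last_squared_ord2.
by apply: (ord_geM (d := 1) (e := 1)) (h1 i); apply: ord_ge_psX.
Qed.

(** Modulo [Q] the terms of order at least 2 and all forms but the last vanish, so 1 and L_n span
    the quotient. *)
Lemma last_squared_codim : exists l : R, forall f, exists a b : k, Q (f - a *: (1 : R) - b *: l).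
Proof.
have idQ := last_squared_is_ideal; have [_ QD _] := idQ.
have {QD} main f : exists a (d : 'I_n -> k),
    Q (f - a *: (1 : R) - \sum_(i : 'I_n | i.+1 == n) d i *: L i).
  have [f1 [/ord_ge_lin_last[v Qf1] Ef]] := psD0 f.
  have [d vE] := independent_forms_span v; exists (pscoef f 0%MM), d.
  rewrite {1}Ef [_ + f1]addrC addrK -[f1](subrK (lin_form v)) -addrA; apply: QD => //.
  rewrite vE (bigID (fun i : 'I_n => i.+1 == n)) /= addrAC subrr add0r.
  by apply: ideal_sum => // i i_n; apply: idealZ => //; apply: last_squared_mem.
(* The sum has the single term L_n, or none when [n = 0]; this covers both cases with one
   witness. *)
exists (\sum_(i : 'I_n | i.+1 == n) L i) => f; have [a [d Qf]] := main f.
have [i i_n|no_last] := pickP (fun i : 'I_n => i.+1 == n).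
  have last1 (G : 'I_n -> R) : \sum_(j : 'I_n | j.+1 == n) G j = G i.
    rewrite (big_pred1 i) // => j /=; apply/eqP/eqP => [j_n|->]; last exact/eqP.
    by apply/val_inj/succn_inj; rewrite (eqP i_n) j_n.
  by exists a, (d i); move: Qf; rewrite !last1.
by exists a, 0; move: Qf; rewrite !big_pred0 // scale0r.
Qed.

Lemma last_squared_rank s K (U : 'M[k]_#|{: 'X_{1..n < s}}|) :
  represents U K -> Q `<=` K -> (#|{: 'X_{1..n < s}}| <= \rank U + 2)%N.
Proof.
move=> UK QK; have [l lP] := last_squared_codim.
suff full : (1%:M <= U + (ps_row s (1 : R) + ps_row s l))%MS.
  have := mxrankS full; rewrite mxrank1 => /leq_trans; apply.
  apply: leq_trans (mxrank_adds_leqif _ _) _; rewrite leq_add2l.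
  apply: leq_trans (mxrank_adds_leqif _ _) _.
  by apply: (leq_add (n1 := 1) (n2 := 1)); apply: rank_leq_row.
apply/row_subP => i; rewrite -[row i _]row_psK; move: (row_ps _) => f.
have [a [b /QK/UK]] := lP f; rewrite !raddfB /= !linearZ /= !scalerN => fU.
have -> : ps_row s f =
    ps_row s f - a *: ps_row s 1 - b *: ps_row s l + (a *: ps_row s 1 + b *: ps_row s l).
  by rewrite -[X in X + _]addrA -opprD subrK.
by apply: addmx_sub_adds fU _; apply: addmx_sub_adds; apply: scalemx_sub.
Qed.

End Independent.

(** Here [t] is a socle element modulo [K]. Then K + k t has codimension 1 and is proper, so it is
    m, and m^2 = (K + k t) m lies in [K]. *)
Lemma codim2_ideal s K (U : 'M[k]_#|{: 'X_{1..n < s}}|) : is_ideal K -> represents U K ->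
    (\rank U + 2 = #|{: 'X_{1..n < s}}|)%N ->
  exists t, [/\ ord_ge 1 t /\ ~ K t, forall f g, ord_ge 1 f -> ord_ge 1 g -> K (f * g),
    K `<=` ord_ge 1 & forall f, ord_ge 1 f -> adjoin K t f].
Proof.
move=> idK UK rU; have [_ KD KM] := idK.
have K1 : ~ K 1.
  move=> /(ideal_setT idK) KT; rewrite KT in UK.
  by have := represents_setT UK; lia.
have KM1 := proper_ideal_sub idK K1.
have [t Kt Kmt] := ideal_socle UK K1; have idQ := adjoin_ideal idK Kmt.
have [V VQ rV] := represents_adjoin UK Kt.
have Q1 : ~ adjoin K t 1.
  move=> /(ideal_setT idQ) QT; rewrite QT in VQ.
  by have := represents_setT VQ; lia.
have QM1 := proper_ideal_sub idQ Q1.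
have Qt : adjoin K t t by exists 1; rewrite scale1r subrr; case: idK.
have [W WM] : exists W : 'M[k]_#|{: 'X_{1..n < s}}|, represents W (ord_ge 1).
  apply: represents_ex; first exact: ord_ge_ideal.
  exact: subset_trans (represents_ord_ge UK) KM1.
have QE : adjoin K t = ord_ge 1.
  apply: (represents_eq VQ WM QM1); rewrite -ltnS rV -addn2 rU ltn_neqAle rank_leq_row andbT.
  apply/eqP => rW; have /WM/ord_ge1/eqP : (ps_row s (1 : R) <= W)%MS.
    by rewrite submx_full // /row_full rW.
  by rewrite pscoef1 eqxx oner_eq0.
exists t; split=> // [|f g|f]; rewrite -QE // => -[c fc] /QM1 g1.
rewrite -[f](subrK (c *: t)) mulrDl; apply: KD; first by rewrite mulrC; apply: KM.
by rewrite -scale_psAl; apply: idealZ => //; rewrite mulrC; apply: Kmt.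
Qed.

(* The linear forms in [K] span a hyperplane: [L_1 .. L_(n-1)] is a basis of it
   and [L_n] is a linear form outside it. *)
Lemma codim2_last_squared s K (U : 'M[k]_#|{: 'X_{1..n < s}}|) :
    is_ideal K -> represents U K -> (\rank U + 2 = #|{: 'X_{1..n < s}}|)%N ->
  exists L : 'I_n -> R, [/\ forall i, is_linear_form (L i), independent_forms L &
    last_squared_ideal L = K].
Proof.
move=> idK UK rU; have [K0 KD KM] := idK.
have [t [[t1 Kt] KMM KM1 Ktf]] := codim2_ideal idK UK rU.
have Klin f : ord_ge 1 f -> exists v, K (f - lin_form v).
  move=> /ord_ge_lin[v [h [h1 ->]]]; exists v; rewrite addrC addKr.
  by apply: ideal_sum => // i _; apply: KMM => //; apply: ord_ge_psX.
have [|u v Ku Kv|c u Ku|W WP] := @subspace_row k n [set v | K (lin_form v)].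
- by rewrite /= raddf0.
- by rewrite /= raddfD; apply: KD.
- by rewrite /= linearZ; apply: idealZ.
(* As m^2 <= K, the class of [t] modulo [K] is that of a linear form [w]; since m = K + k t, this
   one form completes those in [K] to all linear forms. *)
have [w Kw] := Klin t t1.
have full : (1%:M <= W + w)%MS.
  apply/row_subP => i; move: (row i _) => v.
  have [c Kc] := Ktf _ (ord_ge_lin_form v).
  rewrite -[v](subrK (c *: w)) addmx_sub_adds ?scalemx_sub //; apply/WP => /=.
  rewrite raddfB /= linearZ /= -[lin_form v](subrK (c *: t)) -addrA -scalerBr.
  by apply: KD => //; apply: idealZ.
have wW : ~~ (w <= W)%MS.
  by apply/negP => /WP /= Kw'; case: Kt; rewrite -[t](subrK (lin_form w)); apply: KD.
have E : n = (\rank W + 1)%N.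
  apply/eqP; rewrite eqn_leq; apply/andP; split.
    have := mxrankS full; rewrite mxrank1 => /leq_trans; apply.
    by apply: leq_trans (mxrank_adds_leqif _ _) _; rewrite leq_add2l rank_leq_row.
  rewrite addn1; apply: leq_trans (rank_leq_row (W + w)%MS); apply: rank_ltmx.
  by rewrite /ltmx addsmxSl addsmx_sub submx_refl (negPf wW).
pose B := col_mx (row_base W) w.
have B_full : row_full B.
  rewrite -sub1mx; apply: submx_trans full _; rewrite -addsmxE.
  by apply: addsmxS; rewrite ?eq_row_base.
have B_free : row_free B by apply/eqP; move/eqP: B_full => ->.
(* The row [w] is placed last in [B], hence becomes the form that is squared. *)
pose L i := lin_form (row (cast_ord E i) B).
have L_lin i : is_linear_form (L i) by apply: is_linear_lin_form.
have L_ind : independent_forms L.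
  move=> c c0 i; pose c' := \row_j c (cast_ord (esym E) j).
  have : lin_form (c' *m B) = 0.
    rewrite -[RHS]c0 mulmx_sum_row raddf_sum (reindex (cast_ord E)) /=; last first.
      by exists (cast_ord (esym E)) => j _; rewrite (cast_ordK, cast_ordKV).
    by apply: eq_bigr => j _; rewrite linearZ /= !mxE cast_ordK.
  move=> cB; have /eqP : c' *m B = 0.
    by apply/rowP => j; rewrite -pscoef_lin_formU cB mxE.
  rewrite mulmx_free_eq0 // => /eqP /rowP /(_ (cast_ord E i)).
  by rewrite !mxE cast_ordK.
have QK : last_squared_ideal L `<=` K.
  apply: ideal_span_sub => // _ [i _ <-]; case: ifPn => [_|i_n].
    by rewrite expr2; apply: KMM; apply: ord_ge_lin_form.
  apply/WP; case: (split_ordP (cast_ord E i)) => j ij.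
    by rewrite ij rowKu (submx_trans (row_sub _ _)) ?eq_row_base.
  case/eqP: i_n; have := congr1 val ij; rewrite /= => ->.
  by rewrite (ord1 j) addn0 -addn1 -E.
(* Modulo the smaller ideal an element of [K] is a linear form, again in [K], hence a combination of
   the unsquared generators. *)
exists L; split=> //; apply/seteqP; split=> // f Kf.
have [v Qf] := ord_ge_lin_last L_lin L_ind (KM1 _ Kf).
have [_ QD QM] := last_squared_is_ideal L.
rewrite -[f](subrK (lin_form v)); apply: QD => //.
have /WP vW : K (lin_form v).
  rewrite -[lin_form v](subKr f); apply: KD => //; apply: idealN => //; exact: QK.
have /submxP[D ->] : (v <= row_base W)%MS by rewrite eq_row_base.
rewrite mulmx_sum_row raddf_sum; apply: ideal_sum (last_squared_is_ideal L) _ => j _ /=.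
rewrite linearZ /=; apply: idealZ (last_squared_is_ideal L) _.
have -> : lin_form (row j (row_base W)) = L (cast_ord (esym E) (lshift 1 j)).
  by rewrite /L cast_ordKV rowKu.
apply: last_squared_mem; rewrite /= [X in _ != X]E addn1 eqSS neq_ltn.
by have := ltn_ord j => ->.
Qed.

End LinearForms.

(** * Adapted bases *)

Section AdaptedBases.
Set Implicit Arguments.
Unset Strict Implicit.
Unset Printing Implicit Defensive.
Variables (n : nat) (k : fieldType).
Local Notation R := {mpseries k[n]}.
Local Notation S := {mpoly k[n]}.
Implicit Types (f g : R) (F G : S) (M N : set S) (I : set R).

Definition is_subspace M :=
  [/\ M 0, forall F G, M F -> M G -> M (F + G) & forall (c : k) F, M F -> M (c *: F)].

Lemma subspace_sum M (T : finType) (u : T -> S) :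
  is_subspace M -> (forall t, M (u t)) -> M (\sum_t u t).
Proof. by move=> [M0 MD MZ] Mu; elim/big_ind: _. Qed.

Lemma poly_rowK s G : (msize G <= s)%N -> row_poly (poly_row s G) = G.
Proof.
move=> Gs; apply/esym/eqP; rewrite -subr_eq0; apply/eqP/(@poly_row_eq0 _ _ s).
  apply: msize_leP => m sm; rewrite mcoeffB !mcoeff_msize ?subrr //.
    exact: leq_trans (msize_row_poly _) sm.
  exact: leq_trans sm.
by rewrite raddfB /= row_polyK subrr.
Qed.

Lemma subspace_represents s M : is_subspace M ->
  exists U : 'M[k]_#|{: 'X_{1..n < s}}|, forall v, M (row_poly v) <-> (v <= U)%MS.
Proof.
move=> [M0 MD MZ]; apply: (subspace_row (C := [set v | M (row_poly v)])).
- by rewrite /= raddf0.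
- by move=> u v Mu Mv; rewrite /= raddfD; apply: MD.
- by move=> c u Mu; rewrite /= linearZ; apply: MZ.
Qed.

(** The degree bound makes [M] finite-dimensional, and a basis of a complement of the intersection
    of [N] and [M] in [M] is a basis modulo [N]. *)
Lemma basis_mod_ex s N M : is_subspace N -> is_subspace M ->
    (forall G, M G -> (msize G <= s)%N) ->
  exists r (b : 'I_r -> S), basis_mod N M b.
Proof.
move=> sN sM Ms; have [UN UNP] := subspace_represents s sN.
have [UM UMP] := subspace_represents s sM; set D := (UM :\: UN)%MS.
have sumE (c : 'I_(\rank D) -> k) : \sum_i c i *: row_poly (row i (row_base D)) =
    row_poly ((\row_i c i) *m row_base D).
  rewrite mulmx_sum_row raddf_sum; apply: eq_bigr => i _.
  by rewrite /= linearZ /= mxE.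
exists (\rank D), (fun i => row_poly (row i (row_base D))); split=> [i|G MG|c].
- by apply/UMP; rewrite (submx_trans (row_sub _ _)) // eq_row_base diffmxSl.
- have /UMP : M (row_poly (poly_row s G)) by rewrite poly_rowK ?Ms.
  rewrite -(addsmx_diff_cap_eq UM UN) => /sub_addsmxP[[x y] /= xy].
  have /submxP[c cE] : (x *m D <= row_base D)%MS by rewrite eq_row_base submxMl.
  exists (c 0); rewrite sumE -[G](poly_rowK (Ms _ MG)) -raddfB; apply/UNP.
  rewrite xy cE; have -> : \row_i c 0 i = c by apply/rowP => i; rewrite mxE.
  by rewrite addrC addKr; apply: submx_trans (submxMl _ _) (capmxSr _ _).
rewrite sumE => /UNP cN; have cD : ((\row_i c i) *m row_base D <= D)%MS.
  by apply: submx_trans (submxMl _ _) _; rewrite eq_row_base.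
have : ((\row_i c i) *m row_base D <= D :&: UN)%MS by rewrite sub_capmx cD.
rewrite capmx_diff submx0 mulmx_free_eq0 ?row_base_free // => /eqP/rowP c0 i.
by have := c0 i; rewrite !mxE.
Qed.

(** A basis modulo N + k F, with [F] put in front, is a basis modulo [N]. *)
Lemma basis_mod_ex_mem s N M F : is_subspace N -> is_subspace M -> N `<=` M ->
    (forall G, M G -> (msize G <= s)%N) -> M F -> ~ N F ->
  exists r (b a : 'I_r -> _), basis_mod N M b /\ \sum_i (a i : k) *: b i = F.
Proof.
move=> sN sM NM Ms MF NF; have [N0 ND NZ] := sN; have [M0 MD MZ] := sM.
pose N' : set S := [set G | exists c : k, N (G - c *: F)].
have sN' : is_subspace N'.
  split=> [|G G' [c Gc] [d Gd]|e G [c Gc]]; first by exists 0; rewrite scale0r subr0.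
    by exists (c + d); rewrite scalerDl opprD addrACA; apply: ND.
  by exists (e * c); rewrite -scalerA -scalerBr; apply: NZ.
have [r [b [bM bspan bfree]]] := basis_mod_ex sN' sM Ms.
pose b' (i : 'I_r.+1) := if unlift ord0 i is Some j then b j else F.
have sumE (c : 'I_r.+1 -> k) :
    \sum_i c i *: b' i = c ord0 *: F + \sum_i c (lift ord0 i) *: b i.
  rewrite big_ord_recl /b' unlift_none; congr (_ + _).
  by apply: eq_bigr => i _; rewrite liftK.
exists r.+1, b', (fun i => (i == ord0)%:R); split; last first.
  rewrite sumE eqxx scale1r big1 ?addr0 // => i _.
  by rewrite eq_sym (negPf (neq_lift _ _)) scale0r.
split=> [i|G /bspan[c [d Nd]]|c Nc].
- by rewrite /b'; case: unlift.
- exists (fun i => if unlift ord0 i is Some j then c j else d).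
  rewrite sumE unlift_none opprD addrCA addrC.
  have -> : \sum_i (if unlift ord0 (lift ord0 i) is Some j then c j else d) *: b i =
      \sum_i c i *: b i by apply: eq_bigr => i _; rewrite liftK.
  by [].
have c1 i : c (lift ord0 i) = 0.
  move: i; apply: (bfree (fun i => c (lift ord0 i))); exists (- c ord0).
  by rewrite scaleNr opprK addrC -sumE.
have c0 : c ord0 = 0.
  apply/eqP; apply: contraPT Nc => c0 Nc; apply: NF.
  rewrite -[F]scale1r -(mulVf c0) -scalerA; apply: NZ.
  by move: Nc; rewrite sumE big1 ?addr0 // => i _; rewrite c1 scale0r.
by move=> i; case: (unliftP ord0 i) => [j|] ->.
Qed.

(** * Layers of the integrals of I^perp *)

Lemma level_subspace I i : is_subspace (level I i).
Proof.
split=> [f _|F G HF HG f If|c F HF f If]; first by rewrite raddf0; apply: perp0.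
  by rewrite raddfD; apply: perpD; [apply: HF | apply: HG].
by rewrite linearZ; apply: perpZ; apply: HF.
Qed.

Lemma ideal_pow_ideal i : is_ideal (ideal_pow (@ps_maxideal n k) i).
Proof. by case: i => [|i]; [split | apply: ideal_span_ideal]. Qed.

Lemma ideal_powS i :
  ideal_pow (@ps_maxideal n k) i.+1 `<=` ideal_pow (@ps_maxideal n k) i.
Proof.
apply: ideal_span_sub; first exact: ideal_pow_ideal.
by move=> _ [x [y [_ Iy ->]]]; have [_ _ PM] := ideal_pow_ideal i; apply: PM.
Qed.

Lemma ideal_powM i f g : ord_ge 1 f -> ideal_pow (@ps_maxideal n k) i g ->
  ideal_pow (@ps_maxideal n k) i.+1 (f * g).
Proof.
by move=> f1 Ig; apply: sub_ideal_span; exists f, g; split=> //; apply/ord_ge1.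
Qed.

Lemma levelS I i : level I i `<=` level I i.+1.
Proof. by move=> G HG f /ideal_powS; apply: HG. Qed.

Lemma level0 I : level I 0 = perp I.
Proof.
apply/seteqP; split=> [G HG|G IG f _]; last exact: perp_contract.
by rewrite -[G]contract1; apply: HG.
Qed.

Lemma ideal_pow1E f : ideal_pow (@ps_maxideal n k) 1 f <-> ord_ge 1 f.
Proof.
split=> [|f1]; last by rewrite -[f]mulr1; apply: ideal_powM.
by move: f; apply: ideal_span_sub; [apply: ord_ge_ideal | move=> _ [x [y [/ord_ge1 x1 _ ->]]];
  rewrite mulrC; have [_ _ PM] := @ord_ge_ideal n k 1; apply: PM].
Qed.

Lemma level1P I G : level I 1 G <-> (forall f, ord_ge 1 f -> perp I (contract f G)).
Proof. by split=> HG f /ideal_pow1E; apply: HG. Qed.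

Lemma level2P I G : level I 2 G <->
  (forall f g, ord_ge 1 f -> ord_ge 1 g -> perp I (contract (f * g) G)).
Proof.
split=> [HG f g f1 g1|HG]; first by apply/HG/ideal_powM => //; apply/ideal_pow1E.
apply: ideal_span_sub; first exact: perp_colon_ideal.
by move=> _ [f [g [/ord_ge1 f1 /ideal_pow1E g1 ->]]]; apply: HG.
Qed.

(** A monomial of degree at least s + 2 is a sum of products from m m m^s, and m^s <= I kills m^2 o
    G. This bound makes the layers finite-dimensional. *)
Lemma msize_level2 s I G : ord_ge s `<=` I -> level I 2 G -> (msize G <= s.+2)%N.
Proof.
move=> sI /level2P HG; apply: msize_leP => m sm.
have /ord_ge_decomp2[h [hs hE]] : ord_ge s.+2 (psmon k m).
  by apply: (@ord_ge_leq _ _ s.+2 (mdeg m)) => //; apply: ord_ge_psmon.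
have : contract (psmon k m) G = 0.
  rewrite -/(ann G _) hE; have idG := ann_ideal G.
  apply: (ideal_sum idG) => i _; apply: (ideal_sum idG) => j _.
  rewrite /ann /= mulrC contractM; apply: HG; try exact: ord_ge_psX.
  exact: sI.
by move=> /(congr1 (mcoeff 0%MM)); rewrite mcoeff_contract_psmon addm0 mcoeff0.
Qed.

(** Bases of the successive quotients of a filtration together form a basis, so a construction need
    only provide the layers. *)
Lemma adapted_basis_layers I (h : 'I_2 -> nat) (b : forall i : 'I_2, 'I_(h i) -> S) :
  (forall i : 'I_2, basis_mod (level I i) (level I i.+1) (b i)) -> adapted_basis I b.
Proof.
move=> bP; split=> //; pose i1 : 'I_2 := lift ord0 ord0.
pose tg (i : 'I_2) (j : 'I_(h i)) := existT (fun i : 'I_2 => 'I_(h i)) i j.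
have sumE (c : {i : 'I_2 & 'I_(h i)} -> k) : \sum_t c t *: b (tag t) (tagged t) =
    \sum_j c (tg ord0 j) *: b ord0 j + \sum_j c (tg i1 j) *: b i1 j.
  transitivity (\sum_i \sum_(j < h i) c (tg i j) *: b i j).
    by rewrite sig_big_dep; apply: eq_bigr => -[].
  by rewrite big_ord_recl big_ord_recl big_ord0 addr0.
have [m0 s0 f0] := bP ord0; have [m1 s1 f1] := bP i1.
have sub2 i : (i <= 2)%N -> level I i `<=` level I 2.
  by case: i => [|[|[|]]] // _ G HG; do ?[exact: HG | apply: levelS].
have [_ D1 Z1] := level_subspace I 1.
rewrite -level0; split=> [[i j]|G|c] /=.
- by have [mi _ _] := bP i; apply: (sub2 i.+1 (ltn_ord i)); apply: mi.
- move=> /s1[c1 /s0[c0 Gc]].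
  (* The coefficient families [c0] and [c1] have types depending on [i]; stating the values through
     transport along [i = ord0] or [i = i1] glues them into one family. *)
  have cs i : {c : 'I_(h i) -> k | (forall e : i = ord0, c = c0 \o cast_ord (congr1 h e)) /\
      (forall e : i = i1, c = c1 \o cast_ord (congr1 h e))}.
    apply: cid; case: (unliftP ord0 i) => [j|] ->.
      rewrite ord1; exists c1; split=> // e; apply: funext => x /=.
      by congr c1; apply: val_inj.
    exists c0; split=> // e; apply: funext => x /=.
    by congr c0; apply: val_inj.
  exists (fun t => sval (cs (tag t)) (tagged t)); rewrite sumE /=.
  have E0 : sval (cs ord0) = c0.
    rewrite ((svalP (cs ord0)).1 erefl); apply: funext => x /=.
    by congr c0; apply: val_inj.
  have E1 : sval (cs i1) = c1.
    rewrite ((svalP (cs i1)).2 erefl); apply: funext => x /=.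
    by congr c1; apply: val_inj.
  by rewrite E0 E1 [X in G - X]addrC opprD addrA.
rewrite sumE => Nc.
(* The first-layer part of the sum lies in [level I 1], so freeness of the second layer applies
   before that of the first. *)
have c1 j : c (tg i1 j) = 0.
  apply: (f1 (fun j => c (tg i1 j))).
  have -> : \sum_j c (tg i1 j) *: b i1 j =
      (\sum_j c (tg ord0 j) *: b ord0 j + \sum_j c (tg i1 j) *: b i1 j) +
      -1 *: \sum_j c (tg ord0 j) *: b ord0 j.
    by rewrite scaleN1r addrAC subrr add0r.
  apply: D1; first exact: levelS.
  by apply/Z1; apply: (subspace_sum (level_subspace I 1)) => j'; apply/Z1/m0.
have c0 j : c (tg ord0 j) = 0.
  apply: (f0 (fun j => c (tg ord0 j))); move: Nc.
  by rewrite [X in _ + X]big1 ?addr0 // => j' _; rewrite c1 scale0r.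
move=> [i j]; case: (unliftP ord0 i) j => [i'|] ->; last exact: c0.
by rewrite (ord1 i') => j; exact: c1.
Qed.

(** Since [F] is outside [level I 1], it can be a member of the second layer; the first layer then
    receives coefficients 0. *)
Lemma adapted_basis_ex s I F : ord_ge s `<=` I -> level I 2 F -> ~ level I 1 F ->
  exists (h : 'I_2 -> nat) (b : forall i : 'I_2, 'I_(h i) -> S)
         (a : forall i : 'I_2, 'I_(h i) -> k),
    adapted_basis I b /\ \sum_(i < 2) \sum_(j < h i) a i j *: b i j = F.
Proof.
move=> sI F2 F1; have lev i := level_subspace I i.
have size2 i G : (i <= 2)%N -> level I i G -> (msize G <= s.+2)%N.
  move=> i2 HG; apply: (msize_level2 sI).
  by case: i i2 HG => [|[|[|]]] // _ HG; do ?[exact: HG | apply: levelS].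
have ex (i : 'I_2) : {rba : {r : nat & (('I_r -> S) * ('I_r -> k))%type} |
    basis_mod (level I i) (level I i.+1) (projT2 rba).1 /\
    \sum_j (projT2 rba).2 j *: (projT2 rba).1 j = if i == ord0 then 0 else F}.
  apply: cid; case: (unliftP ord0 i) => [j|] -> /=.
    have [r [b [a [bP aF]]]] := basis_mod_ex_mem (lev 1%N) (lev 2%N) (@levelS I 1)
      (fun G => @size2 2%N G isT) F2 F1.
    by rewrite (ord1 j); exists (existT _ r (b, a)).
  have [r [b bP]] := basis_mod_ex (lev 0%N) (lev 1%N) (fun G => @size2 1%N G isT).
  exists (existT _ r (b, fun=> 0)); split=> //=.
  by rewrite big1 // => j _; rewrite scale0r.
exists (fun i => projT1 (sval (ex i))), (fun i => (projT2 (sval (ex i))).1),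
  (fun i => (projT2 (sval (ex i))).2); split.
  by apply: adapted_basis_layers => i; have [] := svalP (ex i).
rewrite big_ord_recl big_ord_recl big_ord0 addr0.
by rewrite (svalP (ex ord0)).2 (svalP (ex (lift ord0 ord0))).2 /= add0r.
Qed.

End AdaptedBases.

(** * The criterion for Gorenstein colength two *)

Theorem proposition3p14 (k : fieldType) (n : nat) (I : idealr {mpseries k[n]})
    (hArtin : artin_local {ideal_quot I})
    (hGor : ~ gorenstein {ideal_quot I})
    (hTeter : ~ teter {ideal_quot I}) :
  has_gcl I 2 <->
  exists (h : 'I_2 -> nat) (b : forall i : 'I_2, 'I_(h i) -> {mpoly k[n]})
         (a : forall i : 'I_2, 'I_(h i) -> k) (L : 'I_n -> {mpseries k[n]}),
    let F := \sum_(i < 2) \sum_(j < h i) a i j *: b i j in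
    [/\ level [set` I] 2 F,
        adapted_basis [set` I] b,
        (forall i, is_linear_form (L i)),
        independent_forms L
      & contract_set (last_squared_ideal L) F = perp [set` I]].
Proof.
have idI := idealr_is_ideal I.
have [s sI] : exists s, ord_ge s `<=` [set` I].
  have [p [p_surj p_ker]] := ideal_quot_morph I.
  exact: artinian_ord_ge p_surj p_ker hArtin.1.
split=> [[[J [[F [J_ann perp_F]] cJ]] _]|[h [b [a [L]]]]].
  have [U UK] := colon_represents I F.
  have rU := (cover_colengthE sI J_ann perp_F 2 UK).1 cJ.
  have idK := perp_colon_ideal [set` I] F.
  have [t [[t1 Kt] KMM _ _]] := codim2_ideal idK UK rU.
  have [L [L_lin L_ind LK]] := codim2_last_squared idK UK rU.
  have F2 : level [set` I] 2 F by apply/level2P => f g; apply: KMM.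
  have [|h [b [a [bP aF]]]] := adapted_basis_ex sI F2.
    by move=> /level1P /(_ t t1).
  exists h, b, a, L; rewrite aF; split=> //; rewrite LK; apply/seteqP; split=> G.
    by move=> [f Kf <-].
  by move=> IG; have [f _ fG] := perp_F _ IG; exists f; rewrite //= fG.
set F := \sum_(i < 2) _ => -[_ _ L_lin L_ind LF].
(* As [I] lies in m, the constant 1 is in I^perp and so is some f0 o F; hence [F] is nonzero and
   [ann F] is proper, as [idealr] requires. *)
have [f0 _ f0F] : contract_set (last_squared_ideal L) F 1.
  rewrite LF => f If; apply: contract_ord_ge; rewrite msize1.
  exact: proper_ideal_sub idI (@idealr_not1 _ _ I) _ If.
have [|J J_ann] := idealr_of_ideal (ann_ideal F).
  rewrite /ann /= contract1 => F0; move: f0F; rewrite F0 raddf0 => /eqP.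
  by rewrite eq_sym oner_eq0.
have perp_F : perp [set` I] `<=` cyclic_submod F by rewrite -LF => _ [f _ <-]; exists f.
have ge2 J' c : gorenstein_cover I J' -> cover_colength I J' c -> (2 <= c)%N.
  move=> [F' [J'_ann perp_F']]; case: c => [|[|c]] // cJ'.
    by case: hGor; apply: cover_colength0 sI J'_ann perp_F' cJ'.
  by case: hTeter; apply: cover_colength1 sI J'_ann perp_F' cJ'.
split=> //; exists J; have cover : gorenstein_cover I J by exists F.
split=> //; have [U UK] := colon_represents I F.
have QK : last_squared_ideal L `<=` [set f | perp [set` I] (contract f F)].
  by move=> f Qf; rewrite /= -LF; exists f.
have rU := last_squared_rank L_lin L_ind UK QK.
have colen := cover_colengthE sI J_ann perp_F _ UK.
(* The colength of this cover is the codimension of [K], at most 2 by [rU]; [ge2] gives the other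
   bound. *)
have := ge2 _ _ cover ((colen (#|{: 'X_{1..n < msize F}}| - \rank U)%N).2 _).
rewrite subnKC ?rank_leq_row // => /(_ erefl) c2.
by apply/colen; lia.
Qed.
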